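(* An Abelian group $G$ with maximal torsion subgroup $T$ is absolutely generalized co-Bassian if and only if it is generalized co-Bassian, i.e., if and only if either $G$ is divisible, or $G/T$ is divisible of finite rank and, for each prime $p$, $T_p$ has generalized finite $p$-rank.
   Context: All groups are Abelian, written additively. An injection between groups means an injective homomorphism. $T = T(G)$ is the maximal torsion subgroup of $G$ and $T_p$ is its $p$-primary component. $\mathbb{Z}(p^n)$ is the cyclic group of order $p^n$, $\mathbb{Z}(p^\infty)$ is the quasi-cyclic (Prüfer) $p$-group, and $X^{(\rho)}$ denotes the direct sum of $\rho$ copies of $X$. A $p$-group $T_p$ has generalized finite $p$-rank if there are elements $\alpha_1 < \alpha_2 < \cdots < \alpha_n$ of $\omega \cup \{\infty\}$ and cardinals $\rho_i$ ($i = 1, \dots, n$) such that $T_p \cong \mathbb{Z}(p^{\alpha_1})^{(\rho_1)} \oplus \cdots \oplus \mathbb{Z}(p^{\alpha_n})^{(\rho_n)}$, where $\rho_j$ is finite whenever $j > 1$. For a subgroup $A$ of a group $X$, a subgroup $V \leq X$ is $A$-high if it is maximal with respect to $V \cap A = \{0\}$; $A$ is an absolute direct summand of $X$ if $X = A \oplus V$ for every $A$-high subgroup $V$ of $X$. A group $G$ is generalized co-Bassian if, for every subgroup $H \leq G$ and every injection $\phi : G \to G/H$, $\phi(G)$ is a direct summand of $G/H$. A group $G$ is absolutely generalized co-Bassian if, for every subgroup $H \leq G$ and every injection $\phi : G \to G/H$, $\phi(G)$ is an absolute direct summand of $G/H$. *)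

(* Defs.v *)
From HB Require Import structures.
From mathcomp Require Import all_boot all_order all_algebra.
From mathcomp Require Import boolp classical_sets cardinality.

Set Implicit Arguments.
Unset Strict Implicit.
Unset Printing Implicit Defensive.

Import GRing.Theory.
Local Open Scope ring_scope.

(* Abelian groups are zmodTypes, and subgroups are boolean predicates closed   *)
(* under the group operations (zmodClosed).  Propositions are turned into      *)
(* booleans classically, with `[< _ >], so this covers all subgroups.          *)
(* G / H is Quotient.quot H.                                                   *)

Section SubgroupType.
Variables (X : zmodType) (A : zmodClosed X).

Record subgroup := Subgroup { sgval : X; _ : sgval \in A }.

HB.instance Definition _ := [isSub for sgval].
HB.instance Definition _ := [Choice of subgroup by <:].
HB.instance Definition _ := [SubChoice_isSubZmodule of subgroup by <:].

End SubgroupType.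

Section Torsion.
Variable X : zmodType.

Definition torsion : {pred X} :=
  fun x => `[< exists2 n : nat, (0 < n)%N & x *+ n = 0 >].

Lemma torsion_closed : zmod_closed torsion.
Proof.
split=> [|x y /asboolP[m m0 xm] /asboolP[n n0 yn]]; apply/asboolP.
  by exists 1%N; rewrite // mul0rn.
exists (m * n)%N; first by rewrite muln_gt0 m0.
by rewrite mulrnBl mulrnA xm mulnC mulrnA yn !mul0rn subrr.
Qed.

HB.instance Definition _ := GRing.isZmodClosed.Build X torsion torsion_closed.

Definition primary (p : nat) : {pred X} :=
  fun x => `[< exists n : nat, x *+ (p ^ n) = 0 >].

Lemma primary_closed p : zmod_closed (primary p).
Proof.
split=> [|x y /asboolP[m xm] /asboolP[n yn]]; apply/asboolP.
  by exists 0%N; rewrite mul0rn.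
exists (m + n)%N.
by rewrite expnD mulrnBl mulrnA xm mulnC mulrnA yn !mul0rn subrr.
Qed.

HB.instance Definition _ p :=
  GRing.isZmodClosed.Build X (primary p) (primary_closed p).

End Torsion.

Section Image.
Variables (X Y : zmodType) (phi : {additive X -> Y}).

Definition im : {pred Y} := fun y => `[< exists x, phi x = y >].

Lemma im_closed : zmod_closed im.
Proof.
split=> [|_ _ /asboolP[x <-] /asboolP[y <-]]; apply/asboolP.
  by exists 0; rewrite raddf0.
by exists (x - y); rewrite raddfB.
Qed.

HB.instance Definition _ := GRing.isZmodClosed.Build Y im im_closed.

End Image.

Definition isomorphic (X Y : zmodType) : Prop :=
  exists f : {additive X -> Y}, bijective f.

Section DirectSum.
Variables (I : Type) (X : I -> zmodType).

(* External direct sum: finitely supported families. *)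
Record dsum := Dsum {
  dsum_fun :> forall i, X i;
  _ : finite_set [set i | dsum_fun i != 0]%classic }.

Lemma dsum_finite (f : dsum) : finite_set [set i | f i != 0]%classic.
Proof. by case: f. Qed.

Lemma dsumP (f g : dsum) : (forall i, f i = g i) -> f = g.
Proof.
case: f g => [f fF] [g gF] /= fg.
have {}fg : f = g by apply: functional_extensionality_dep.
by subst g; rewrite (Prop_irrelevance fF gF).
Qed.

Lemma dsum0_subproof : finite_set [set i | (0 : X i) != 0]%classic.
Proof.
by apply: (@sub_finite_set _ _ set0) => // i /=; rewrite eqxx.
Qed.
Definition dsum0 := @Dsum (fun=> 0) dsum0_subproof.

Lemma dsumN_subproof (f : dsum) : finite_set [set i | - f i != 0]%classic.
Proof.
by apply: sub_finite_set (dsum_finite f) => i /=; rewrite oppr_eq0.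
Qed.
Definition dsumN (f : dsum) := Dsum (dsumN_subproof f).

Lemma dsumD_subproof (f g : dsum) :
  finite_set [set i | f i + g i != 0]%classic.
Proof.
apply: (@sub_finite_set _ _
  ([set i | f i != 0] `|` [set i | g i != 0])%classic); last first.
  by rewrite finite_setU; split; exact: dsum_finite.
move=> i /=; case: (eqVneq (f i) 0) => [->|]; last by left.
by rewrite add0r; right.
Qed.
Definition dsumD (f g : dsum) := Dsum (dsumD_subproof f g).

HB.instance Definition _ := gen_eqMixin dsum.
HB.instance Definition _ := gen_choiceMixin dsum.

Lemma dsumDA : associative dsumD.
Proof. by move=> f g h; apply: dsumP => i /=; rewrite addrA. Qed.
Lemma dsumDC : commutative dsumD.
Proof. by move=> f g; apply: dsumP => i /=; rewrite addrC. Qed.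
Lemma dsum0D : left_id dsum0 dsumD.
Proof. by move=> f; apply: dsumP => i /=; rewrite add0r. Qed.
Lemma dsumND : left_inverse dsum0 dsumN dsumD.
Proof. by move=> f; apply: dsumP => i /=; rewrite addNr. Qed.

HB.instance Definition _ :=
  GRing.isZmodule.Build dsum dsumDA dsumDC dsum0D dsumND.

End DirectSum.

(* X^(rho), the cardinal rho being represented by a type of that cardinality. *)
Definition copies (rho : Type) (X : zmodType) : zmodType :=
  dsum (fun _ : rho => X).

Definition integers : {pred rat} := fun x => x \is a Num.int.

Lemma integers_closed : zmod_closed integers.
Proof. by split=> [|x y xZ yZ]; [exact: rpred0 | exact: rpredB]. Qed.

HB.instance Definition _ := GRing.isZmodClosed.Build rat integers integers_closed.

(* The p-primary component of Q/Z. *)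
Definition prufer (p : nat) : zmodType :=
  subgroup (primary (X := Quotient.quot integers) p).

(* Z(p^a) for a in omega + {oo}, with None standing for oo.  The form          *)
(* (p ^ n).-1.+1 provides the group structure; unlike 'Z_(p ^ n), it is        *)
(* trivial when n = 0.                                                         *)
Definition Zpow (p : nat) (a : option nat) : zmodType :=
  if a is Some n then 'I_(p ^ n).-1.+1 else prufer p.

Definition lt_oo (a b : option nat) : bool :=
  match a, b with
  | Some m, Some n => (m < n)%N
  | Some _, None => true
  | None, _ => false
  end.

Definition generalized_finite_prank (p : nat) (X : zmodType) : Prop :=
  exists (n : nat) (alpha : 'I_n.+1 -> option nat) (rho : 'I_n.+1 -> Type),
    [/\ forall i j : 'I_n.+1, (i < j)%N -> lt_oo (alpha i) (alpha j),
        forall j : 'I_n.+1, (0 < j)%N -> finite_set [set: rho j]%classic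
      & isomorphic X (dsum (fun i => copies (rho i) (Zpow p (alpha i))))].

Definition divisible (X : zmodType) : Prop :=
  forall (n : nat) (x : X), (0 < n)%N -> exists y : X, y *+ n = x.

Definition independent (X : zmodType) (k : nat) (v : 'I_k -> X) : Prop :=
  forall c : 'I_k -> int, \sum_(i < k) v i *~ c i = 0 -> forall i, c i = 0.

(* For torsion-free X: the largest number of linearly independent elements     *)
(* exists and is r.                                                            *)
Definition has_rank (X : zmodType) (r : nat) : Prop :=
  (exists v : 'I_r -> X, independent v) /\
  (forall (k : nat) (v : 'I_k -> X), independent v -> (k <= r)%N).

Definition finite_rank (X : zmodType) : Prop := exists r : nat, has_rank X r.

Section Summands.
Variable X : zmodType.

Definition meets_trivially (V A : zmodClosed X) : Prop :=
  forall x, x \in V -> x \in A -> x = 0.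

Definition is_high (A V : zmodClosed X) : Prop :=
  meets_trivially V A /\
  forall W : zmodClosed X,
    {subset V <= W} -> meets_trivially W A -> {subset W <= V}.

Definition direct_decomposition (A V : zmodClosed X) : Prop :=
  (forall x, exists a v, [/\ a \in A, v \in V & x = a + v]) /\
  meets_trivially V A.

Definition direct_summand (A : zmodClosed X) : Prop :=
  exists V : zmodClosed X, direct_decomposition A V.

Definition absolute_direct_summand (A : zmodClosed X) : Prop :=
  forall V : zmodClosed X, is_high A V -> direct_decomposition A V.

End Summands.

Definition generalized_coBassian (G : zmodType) : Prop :=
  forall (H : zmodClosed G) (phi : {additive G -> Quotient.quot H}),
    injective phi -> direct_summand (im phi).

Definition absolutely_generalized_coBassian (G : zmodType) : Prop :=
  forall (H : zmodClosed G) (phi : {additive G -> Quotient.quot H}),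
    injective phi -> absolute_direct_summand (im phi).

(* Main.v *)
(* Generalized co-Bassian groups are used through one consequence: if [q] maps *)
(* [G] onto [Y] and [psi] embeds [G] in [Y], then [psi] has a retraction.      *)
(* Let [M <= G], let [E] be a group with an embedding [M -> E] and a           *)
(* surjection [M -> E] that both extend to [G]; then [E * G / M] is a quotient *)
(* of [G] in which [G] embeds, so an element of [M] that becomes divisible by  *)
(* [n] in [E] is already divisible by [n] in [G].  With [E = Q^(omega)] this   *)
(* shows that [G] is divisible when [G / T] has infinite rank; with            *)
(* [E = Z(p^oo)^(omega)] or [Z(p^(n+1))^(omega)] it shows that, when [T_p] is  *)
(* not divisible and [k] is least with [G[p^(k+1)]] not contained in [pG], the *)
(* socle of [p^(k+1) T_p] is finite.  Then homogeneous summands of exponents   *)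
(* [p^(k+1)], [p^(k+2)], ... and finally [p^oo] split off from [G], which      *)
(* gives the structure of [T_p] and [G = T_p + C]; multiplication by [p] on    *)
(* [C] shows that [G / T] is [p]-divisible.                                    *)
(* Conversely, if [phi : G -> G / H] is injective and [G / T] has finite rank, *)
(* then [H] and [(G / H) / phi(G)] are torsion, and counting in the finite     *)
(* groups [p^(k+1) T_p[p^m]] shows [p^(k+1) (T_p / H_p) <= phi(G)]; this       *)
(* forces every [phi(G)]-high subgroup to be a complement.                     *)

From HB Require Import structures.
From mathcomp Require Import all_boot all_algebra.
From mathcomp Require Import boolp classical_sets cardinality fsbigop.
Require Import Defs.

Set Implicit Arguments.
Unset Strict Implicit.
Unset Printing Implicit Defensive.

Import GRing.Theory Num.Theory.
Local Open Scope quotient_scope.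
Local Open Scope ring_scope.

(** The proof is a cycle of implications. Absolutely generalized co-Bassian groups are generalized
    co-Bassian because high subgroups exist ([high_exists]).

    Next, let [G] be generalized co-Bassian. By [coBassian_retraction] an embedding of [G] in a
    quotient of [G] creates no new divisibility. [coBassian_divides] builds such embeddings out of
    independent sequences. An infinite rank of [G / T] leaves room for the rationals and makes [G]
    divisible ([infinite_rank_divisible]). Too large a socle leaves room for primary groups
    ([coBassian_bounded_or_divisible]). The resulting condition [bounded_or_divisible] amounts to
    generalized finite p-rank, since homogeneous layers split off one after another ([cyclic_layer],
    [prufer_layer]). With the p-torsion split off, multiplication by [p] on the complement shows
    that [G / T] is p-divisible ([coBassian_quot_divisible]).

    Finally, for an embedding [phi] of [G] in [G / H] and a high subgroup [V], [high_decomposition]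
    asks only that [g] be divisible by [p] whenever [p x = phi g + v]. If [G / T] is divisible of
    finite rank, this reduces to [g] in [T_p], where counting in a group with finite socle
    ([coHopfian]) decides. *)

(** * Subgroups and homomorphisms from predicates and relations *)

Lemma subgroup_exists (X : zmodType) (P : X -> Prop) :
  P 0 -> (forall x y, P x -> P y -> P (x - y)) ->
  exists W : zmodClosed X, forall x, (x \in W) <-> P x.
Proof.
move=> P0 PB; pose S : {pred X} := fun x => `[< P x >].
have SP x : (x \in S) <-> P x by split=> /asboolP.
have Sc : zmod_closed S.
  by split=> [|x y /SP Px /SP Py]; apply/SP => //; apply: PB.
pose W : zmodClosed X := HB.pack S (GRing.isZmodClosed.Build X S Sc).
by exists W => x; apply: SP.
Qed.

Lemma trivial_subgroup (G : zmodType) :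
  exists U : zmodClosed G, forall x, (x \in U) <-> x = 0.
Proof. by apply: subgroup_exists => // a b -> ->; rewrite subr0. Qed.

Lemma kernel_subgroup (G E : zmodType) (r : {additive G -> E}) :
  exists K : zmodClosed G, forall x, (x \in K) <-> r x = 0.
Proof.
apply: subgroup_exists => [|x y rx ry]; first by rewrite raddf0.
by rewrite raddfB rx ry subr0.
Qed.

Lemma multiples_subgroup (G : zmodType) n :
  exists U : zmodClosed G, forall x, (x \in U) <-> exists g, x = g *+ n.
Proof.
apply: subgroup_exists; first by exists 0; rewrite mul0rn.
by move=> _ _ [a ->] [b ->]; exists (a - b); rewrite mulrnBl.
Qed.

Lemma adjoin_subgroup (G : zmodType) (V : zmodClosed G) (x : G) :
  exists W : zmodClosed G, forall y, (y \in W) <-> exists v c, v \in V /\ y = v + x *~ c.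
Proof.
apply: subgroup_exists; first by exists 0, 0; rewrite rpred0 mulr0z addr0.
move=> _ _ [v [c [vV ->]]] [w [d [wV ->]]]; exists (v - w), (c - d).
by rewrite rpredB // mulrzBr opprD addrACA.
Qed.

Lemma additive_exists (A B : zmodType) (f : A -> B) :
  (forall x y, f (x - y) = f x - f y) ->
  exists F : {additive A -> B}, forall a, F a = f a.
Proof.
move=> fB; pose F : {additive A -> B} := HB.pack f (GRing.isZmodMorphism.Build A B f fB).
by exists F.
Qed.

(** An additive relation is single-valued as soon as it is so at 0. This yields maps described
    through preimages or complements without checking independence of choices. *)
Lemma additive_of_rel (A B : zmodType) (R : A -> B -> Prop) :
  (forall a, exists b, R a b) -> (forall b, R 0 b -> b = 0) ->
  (forall a b a' b', R a b -> R a' b' -> R (a - a') (b - b')) ->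
  exists f : {additive A -> B}, forall a b, R a b <-> f a = b.
Proof.
move=> Rtot R0 RB; have [f fR] := choice Rtot.
have Rfun a b b' : R a b -> R a b' -> b = b'.
  move=> Rb Rb'; apply/eqP; rewrite -subr_eq0; apply/eqP/R0.
  by rewrite -(subrr a); apply: RB.
have [|F FE] := @additive_exists _ _ f.
  by move=> x y; apply: Rfun (fR _) _; apply: RB.
exists F => a b; rewrite FE; split=> [Rb|<- //].
by apply: Rfun (fR a) Rb.
Qed.

(** * High subgroups *)

Section High.
Variables (X : zmodType).
Implicit Types (A V W : zmodClosed X).

Lemma high_exists A V :
  meets_trivially V A -> exists2 W, is_high A W & {subset V <= W}.
Proof.
move=> VA.
pose Q (S : set X) := [/\ forall x, x \in V -> S x,
  forall x y, S x -> S y -> S (x - y) & forall x, S x -> x \in A -> x = 0].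
have Q0 S : Q S -> S 0 by case=> + _ _; apply; apply: rpred0.
(* The extra case serves the empty chain, whose union is empty and hence not a subgroup. *)
pose P S := S = set0 \/ Q S.
have [|S [PS Smax]] := @Zorn_bigcup X P.
  move=> F FP Ftot.
  have [[B FB /set0P B0]|noB] := pselect (exists2 B, F B & B != set0); last first.
    left; apply/seteqP; split=> // x [B FB Bx]; case: noB; exists B => //.
    by apply/set0P; exists x.
  have FQ C x : F C -> C x -> Q C.
    by move=> /FP[-> //|].
  have [b Bb] := B0; right; split.
  - by move=> x Vx; exists B => //; have [+ _ _] := FQ _ _ FB Bb; apply.
  - move=> x y [C FC Cx] [D FD Dy].
    have [CD|DC] := Ftot _ _ FC FD.
      by exists D => //; have [_ + _] := FQ _ _ FD Dy; apply=> //; apply: CD.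
    by exists C => //; have [_ + _] := FQ _ _ FC Cx; apply=> //; apply: DC.
  - by move=> x [C FC Cx]; have [_ _ +] := FQ _ _ FC Cx; apply.
have QV : Q [set x | x \in V]%classic.
  by split=> //= x y; apply: rpredB.
have {PS}QS : Q S.
  case: PS => // S0; exfalso; apply: (Smax [set x | x \in V]%classic); last by right.
  rewrite S0; split=> // VS; exact: (VS 0 (rpred0 _)).
have [VS SB SA] := QS.
have [W WP] := subgroup_exists (Q0 _ QS) SB.
exists W; last by move=> x /VS /WP.
split=> [x /WP|U WU UA u uU]; first exact: SA.
apply/WP; apply: contrapT => nSu; apply: (Smax [set x | x \in U]%classic).
  by split=> [x /WP /WU //|/(_ u uU)].
right; split=> //= [x Vx|x y]; last exact: rpredB.
by apply/WU/WP/VS.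
Qed.

Lemma prime_closed W :
    (forall p x, prime p -> x *+ p \in W -> x \in W) ->
  forall n x, (0 < n)%N -> x *+ n \in W -> x \in W.
Proof.
move=> Wp n; elim/ltn_ind: n => n IH x n0 xn.
have [n1|n1] := leqP n 1.
  by move: xn; have -> : n = 1%N by apply/eqP; rewrite eqn_leq n1.
have pp := pdiv_prime n1; have dn := pdiv_dvd n.
apply: (IH (n %/ pdiv n)%N).
- by rewrite ltn_Pdiv ?prime_gt1.
- by rewrite divn_gt0 ?prime_gt0 // dvdn_leq.
by apply: (Wp (pdiv n)); rewrite // -mulrnA divnK.
Qed.

Lemma high_adjoin A V x : is_high A V ->
    (forall v c, v \in V -> v + x *~ c \in A -> v + x *~ c = 0) ->
  x \in V.
Proof.
move=> [_ Vmax] xV.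
have [W WP] := adjoin_subgroup V x.
apply: (Vmax W).
- by move=> v vV; apply/WP; exists v, 0; rewrite mulr0z addr0.
- by move=> _ /WP[v [c [vV ->]]]; apply: xV.
- by apply/WP; exists 0, 1; rewrite rpred0 add0r.
Qed.

Definition in_sum A V (x : X) : Prop :=
  exists a v, [/\ a \in A, v \in V & x = a + v].

Lemma sum_subgroup A V :
  exists W : zmodClosed X, forall x, (x \in W) <-> in_sum A V x.
Proof.
apply: subgroup_exists.
  by exists 0, 0; rewrite !rpred0 addr0.
move=> _ _ [a [v [aA vV ->]]] [b [w [bA wV ->]]].
by exists (a - b), (v - w); rewrite !rpredB // opprD addrACA.
Qed.

Lemma prime_bezout (p : nat) (c : int) : prime p -> ~ (p %| c)%Z ->
  exists u v, u * p%:Z + v * c = 1.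
Proof.
move=> pp pc; have /coprimezP[[u v] /= uv] : coprimez p c.
  rewrite coprimezE /= prime_coprime //; apply/negP => h; apply: pc.
  by rewrite dvdzE.
by exists u, v.
Qed.

(** Suppose [x] is outside [A + V] and [v + c x] lies in [A]. If [p] divides [c], this element is
    also in [V], so it is 0; otherwise a Bezout relation recovers [x] from [p x] and [c x], both in
    [A + V]. Maximality then puts [x] in [V]. *)
Lemma high_prime A V p x : is_high A V -> prime p -> x *+ p \in V -> in_sum A V x.
Proof.
move=> hV pp pxV; have [W WP] := sum_subgroup A V.
apply/WP; apply: contrapT => xW.
have AW a : a \in A -> a \in W.
  by move=> aA; apply/WP; exists a, 0; rewrite rpred0 addr0.
have VW v : v \in V -> v \in W.
  by move=> vV; apply/WP; exists 0, v; rewrite rpred0 add0r.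
apply: (xW); apply: (VW); apply: high_adjoin (hV) _ => v c vV vcA.
have [[d cd]|pc] := pselect (exists d, c = d * p%:Z).
  apply: hV.1 vcA; rewrite rpredD // cd mulrC mulrzA -pmulrn.
  exact: rpredMz.
exfalso; apply: xW; have [|u [w uw]] := @prime_bezout p c pp.
  by move=> /dvdzP.
rewrite -[x]mulr1z -uw mulrzDr [u * _]mulrC [w * _]mulrC !mulrzA -pmulrn.
apply: rpredD; apply: rpredMz; first exact: VW.
rewrite -(addKr v (_ *~ _)); apply: rpredD; last exact: AW.
by rewrite rpredN; apply: VW.
Qed.

(** By maximality every [x] has a nonzero multiple in [A + V], so it is enough that [A + V] be
    closed under division by primes. The hypothesis reduces this to [high_prime]. *)
Lemma high_decomposition A V : is_high A V ->
    (forall p x a v, prime p -> a \in A -> v \in V -> x *+ p = a + v ->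
      exists a' v', [/\ a' \in A, v' \in V & (x - a' - v') *+ p \in V]) ->
  direct_decomposition A V.
Proof.
move=> hV step; split; last exact: hV.1.
have [W WP] := sum_subgroup A V.
have AW a : a \in A -> a \in W.
  by move=> aA; apply/WP; exists a, 0; rewrite rpred0 addr0.
have VW v : v \in V -> v \in W.
  by move=> vV; apply/WP; exists 0, v; rewrite rpred0 add0r.
have Wp p x : prime p -> x *+ p \in W -> x \in W.
  move=> pp /WP[a [v [aA vV xE]]].
  have [a' [v' [a'A v'V /(high_prime hV pp) /WP xW]]] := step _ _ _ _ pp aA vV xE.
  rewrite -(subrK a' x) -(subrK v' (x - a')).
  by apply: rpredD (AW _ a'A); apply: rpredD (VW _ v'V).
move=> x; apply/WP.
have [//|nxW] := pselect (x \in W).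
have [c c0 xc] : exists2 c : int, c != 0 & x *~ c \in W.
  apply: contrapT => nc; apply/nxW/VW/(high_adjoin hV) => v c vV vcA.
  have [c0|c0] := eqVneq c 0.
    by move: vcA; rewrite c0 mulr0z addr0 => vA; apply: hV.1.
  case: nc; exists c => //.
  rewrite -(addKr v (_ *~ _)); apply: rpredD; last exact: AW.
  by rewrite rpredN; apply: VW.
apply: (prime_closed Wp) (`|c|%N) _ _ _; first by rewrite absz_gt0.
rewrite pmulrn; case: (intP c) xc => // n.
by rewrite abszN mulrNz rpredN.
Qed.

End High.

Lemma coprime_divide (X : zmodType) (a : X) n q :
  coprime n q -> a *+ n = 0 -> exists c : int, a = a *~ c *+ q.
Proof.
move=> /(coprimezP n q)[[u v] /= uv] an; exists v.
have {1}-> : a = a *~ (n%:Z * u + q%:Z * v) by rewrite mulrC [_ * v]mulrC uv.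
by rewrite mulrzDr !mulrzA -[a *~ n%:Z]pmulrn an mul0rz add0r pmulrn -!mulrzA mulrC.
Qed.

Lemma high_divisible (X : zmodType) (A V : zmodClosed X) :
    (forall p a, prime p -> a \in A -> exists2 b, b \in A & b *+ p = a) ->
  is_high A V -> direct_decomposition A V.
Proof.
move=> Adiv hV; apply: high_decomposition => // p x a v pp aA vV xE.
have [b bA bp] := Adiv p a pp aA; exists b, 0; rewrite rpred0 subr0; split=> //.
by rewrite mulrnBl xE bp addrC addKr.
Qed.

(** If [p x = a + v], then [p^k a = p^(k+1) x - p^k v] lies in both [V] and [A], so it is 0 and [a]
    is divisible by [p] in [A]. *)
Lemma high_homogeneous (X : zmodType) p k (A V : zmodClosed X) :
    prime p -> (forall a, a \in A -> a *+ p ^ k.+1 = 0) ->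
    (forall a, a \in A -> a *+ p ^ k = 0 -> exists2 b, b \in A & b *+ p = a) ->
    (forall x, x *+ p ^ k.+1 \in V) ->
  is_high A V -> direct_decomposition A V.
Proof.
move=> pp Ap Aroot Vp hV; apply: high_decomposition => // q x a v qq aA vV xE.
suff [b bA bq] : exists2 b, b \in A & b *+ q = a.
  exists b, 0; rewrite rpred0 subr0; split=> //.
  by rewrite mulrnBl xE bq addrC addKr.
have [qp|qp] := eqVneq q p; last first.
  have [|c ->] := @coprime_divide _ a (p ^ k.+1) q _ (Ap _ aA).
    by rewrite coprimeXl // prime_coprime // dvdn_prime2 // eq_sym.
  by exists (a *~ c); rewrite ?rpredMz.
rewrite qp; apply: Aroot => //; apply: hV.1; last exact: rpredMn.
have -> : a *+ p ^ k = x *+ p ^ k.+1 - v *+ p ^ k.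
  by rewrite expnS mulrnA -qp xE mulrnDl addrK.
by rewrite rpredB // rpredMn.
Qed.

(** * Extension of homomorphisms *)

(** Injectivity of [E] relative to [U]. The map [j] need not be injective: since 0 is in [U], the
    condition makes [f] vanish on its kernel. *)
Definition extendable (G : zmodType) (U : zmodClosed G) (E : zmodType) :=
  forall (A : zmodType) (j : {additive A -> G}) (f : {additive A -> E}),
    (forall a, j a \in U -> f a = 0) ->
  exists F : {additive G -> E}, forall a, F (j a) = f a.

(* A map extending [f] is a complement of [0 x E] in [G x E] containing the   *)
(* graph of [f].                                                              *)
Lemma extendable_high (G : zmodType) (U : zmodClosed G) (E : zmodType)
    (B : zmodClosed (G * E)%type) :
    (forall x, (x \in B) <-> x.1 = 0) ->
    (forall V : zmodClosed (G * E)%type, (forall u, u \in U -> (u, 0) \in V) ->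
       is_high B V -> direct_decomposition B V) ->
  extendable U E.
Proof.
move=> BP Bdec A j f jf.
have [||V0 V0P] := @subgroup_exists (G * E)%type
  (fun y => exists a u, u \in U /\ y = (j a + u, f a)).
- by exists 0, 0; rewrite rpred0 !raddf0 addr0.
- move=> _ _ [a [u [uU ->]]] [b [v [vU ->]]]; exists (a - b), (u - v).
  by rewrite rpredB // !raddfB addrACA -opprD.
have V0B : meets_trivially V0 B.
  move=> x /V0P[a [u [uU ->]]] /BP /= /eqP; rewrite addr_eq0 => /eqP jau.
  by rewrite jf jau ?subrr ?addNr // rpredN.
have [V hV V0V] := high_exists V0B.
have [|Vdec VB] := Bdec V _ hV.
  by move=> u uU; apply/V0V/V0P; exists 0, u; rewrite !raddf0 add0r.
have [|||F FP] := @additive_of_rel G E (fun x e => (x, e) \in V).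
- move=> x; have [b [[y e] [/BP bB yV bE]]] := Vdec (x, 0).
  by exists e; move: bE; case: b bB => /= b1 b2 -> [->]; rewrite add0r.
- by move=> e eV; have [] : (0, e) = 0 :> G * E by apply: VB => //; apply/BP.
- by move=> a b a' b' aV bV; apply: (rpredB aV bV).
exists F => a; apply/FP/V0V/V0P; exists a, 0; rewrite rpred0 addr0; split=> //.
Qed.

Lemma pair_mulrn (G E : zmodType) (x : G) (e : E) n : (x, e) *+ n = (x *+ n, e *+ n).
Proof. by elim: n => // n IH; rewrite !mulrS IH. Qed.

Lemma extendable_divisible (G : zmodType) (U : zmodClosed G) (E : zmodType) :
  divisible E -> extendable U E.
Proof.
move=> Ediv; have [B BP] := kernel_subgroup (fst : {additive (G * E)%type -> G}).
apply: (extendable_high BP) => V _; apply: high_divisible => p [x e] pp /BP /= ->.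
have [d dp] := Ediv p e (prime_gt0 pp).
by exists (0, d); [apply/BP|rewrite pair_mulrn mul0rn dp].
Qed.

(** Taking [U] to contain [p^(k+1) G] forces the high subgroup to contain [p^(k+1)] times [G x E],
    as [high_homogeneous] requires. *)
Lemma extendable_homogeneous (G : zmodType) (U : zmodClosed G) (E : zmodType) p k :
    prime p -> (forall e : E, e *+ p ^ k.+1 = 0) ->
    (forall e : E, e *+ p ^ k = 0 -> exists d, d *+ p = e) ->
    (forall x, x *+ p ^ k.+1 \in U) ->
  extendable U E.
Proof.
move=> pp Ep Eroot Up; have [B BP] := kernel_subgroup (fst : {additive (G * E)%type -> G}).
apply: (extendable_high BP) => V UV; apply: (high_homogeneous pp (k := k)).
- by move=> [x e] /BP /= ->; rewrite pair_mulrn Ep mul0rn.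
- move=> [x e] /BP /= ->; rewrite pair_mulrn => -[_ /Eroot[d dp]].
  by exists (0, d); [apply/BP|rewrite pair_mulrn mul0rn dp].
- by move=> [x e]; rewrite pair_mulrn Ep; apply: UV.
Qed.

(** * Quotients of co-Bassian groups *)

Section Quotients.
Variables (G : zmodType) (H : zmodClosed G).

Lemma quot_piE (x y : G) :
  (\pi_(Quotient.quot H) x = \pi_(Quotient.quot H) y) <-> (x - y \in H).
Proof. by rewrite Quotient.idealrBE; split=> [->|/eqP]. Qed.

Lemma quot_pi0 (x : G) : (\pi_(Quotient.quot H) x = 0) <-> (x \in H).
Proof. by rewrite -{1}(raddf0 (\pi_(Quotient.quot H))) quot_piE subr0. Qed.

Lemma quot_surj (y : Quotient.quot H) : exists x, \pi_(Quotient.quot H) x = y.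
Proof. by exists (repr y); rewrite reprK. Qed.

End Quotients.

Lemma additive_inj (A B : zmodType) (f : {additive A -> B}) :
  (forall a, f a = 0 -> a = 0) -> injective f.
Proof.
move=> f0 x y fxy; apply/eqP; rewrite -subr_eq0; apply/eqP/f0.
by rewrite raddfB fxy subrr.
Qed.

(** [Y] is [G] modulo the kernel of [q]; the retraction is the projection along a complement of the
    image of [psi]. *)
Lemma coBassian_retraction (G Y : zmodType) (q psi : {additive G -> Y}) :
    generalized_coBassian G -> (forall y, exists x, q x = y) -> injective psi ->
  exists rho : {additive Y -> G}, forall x, rho (psi x) = x.
Proof.
move=> Gco qsurj psi_inj.
have [H HP] := kernel_subgroup q.
pose pi : {additive G -> Quotient.quot H} := \pi_(Quotient.quot H).
have piq x y : pi x = pi y <-> q x = q y.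
  rewrite /pi /= quot_piE HP raddfB; split=> [/eqP|->]; last by rewrite subrr.
  by rewrite subr_eq0 => /eqP.
have [|||phi phiP] := @additive_of_rel G (Quotient.quot H)
  (fun g z => exists2 x, q x = psi g & pi x = z).
- by move=> g; have [x xE] := qsurj (psi g); exists (pi x); exists x.
- by move=> z [x xE <-]; rewrite -(raddf0 pi) piq xE !raddf0.
- move=> a _ b _ [x xE <-] [y yE <-]; exists (x - y); last by rewrite raddfB.
  by rewrite !raddfB xE yE.
have phi_inj : injective phi.
  apply: additive_inj => g /phiP[x xE]; rewrite -(raddf0 pi) piq raddf0 xE.
  by rewrite -(raddf0 psi) => /psi_inj.
have [V [Vdec VI]] := Gco H phi phi_inj.
have [|||rho rhoP] := @additive_of_rel Y G
  (fun y g => exists2 x, q x = y & pi x - phi g \in V).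
- move=> y; have [x <-] := qsurj y.
  have [_ [v [/asboolP[g <-] vV xE]]] := Vdec (pi x).
  by exists g, x => //; rewrite xE addrC addKr.
- move=> g [x]; rewrite -(raddf0 q) -piq raddf0 => ->; rewrite add0r => gV.
  apply: phi_inj; rewrite raddf0; apply/eqP; rewrite -oppr_eq0; apply/eqP/VI => //.
  by rewrite rpredN; apply/asboolP; exists g.
- move=> _ g _ h [x <- xV] [y <- yV]; exists (x - y); first by rewrite raddfB.
  by rewrite (raddfB pi) (raddfB phi) opprD addrACA -opprD rpredB.
exists rho => g; apply/rhoP; have [x xE] := qsurj (psi g); exists x => //.
by have /phiP -> : exists2 x', q x' = psi g & pi x' = pi x;
  [exists x|rewrite subrr rpred0].
Qed.

(** * Direct sums *)

Section DsumTheory.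
Variables (I : Type) (X : I -> zmodType).
Implicit Types f g : dsum X.

Lemma dsumBE f g i : (f - g) i = f i - g i.
Proof. by []. Qed.

Lemma dsumMnE f n i : (f *+ n) i = f i *+ n.
Proof. by elim: n => // n IH; rewrite !mulrS -IH. Qed.

Lemma dsum_make (F : forall i, X i) :
  finite_set [set i | F i != 0]%classic -> exists f : dsum X, forall i, f i = F i.
Proof. by move=> Ffin; exists (Dsum Ffin). Qed.

Lemma dsum_root f n : (forall i, exists x, x *+ n = f i) -> exists g, g *+ n = f.
Proof.
(* The root of 0 is taken to be 0, which keeps the support finite. *)
move=> froot; have root i : exists x, x *+ n = f i /\ (f i = 0 -> x = 0).
  have [f0|f0] := eqVneq (f i) 0; first by exists 0; rewrite mul0rn f0.
  by have [x xn] := froot i; exists x; split=> // fi0; rewrite fi0 eqxx in f0.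
pose F i := sval (cid (root i)); have FP i := svalP (cid (root i)).
have [|g gE] := @dsum_make F.
  apply: sub_finite_set (dsum_finite f) => i /=; apply: contra_neq.
  exact: (FP i).2.
by exists g; apply: dsumP => i; rewrite dsumMnE gE (FP i).1.
Qed.

Lemma dsum_divisible : (forall i, divisible (X i)) -> divisible (dsum X).
Proof. by move=> Xdiv n f n0; apply: dsum_root => i; apply: Xdiv. Qed.

Lemma dsum_finite_box (Q : forall i, set (X i)) :
    finite_set [set: I]%classic -> (forall i, finite_set (Q i)) ->
  finite_set [set f : dsum X | forall i, Q i (f i)]%classic.
Proof.
move=> Ifin Qfin.
have [s sI] : exists s : seq {classic I}, forall i, i \in s.
  have /(@finite_seqP {classic I})[s sE] := Ifin; exists s => i.
  by have : [set: I]%classic i by []; rewrite sE.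
(* Allowing 0 in every coordinate makes the claim stable under erasing one, which is the induction
   step. *)
suff: finite_set [set f : dsum X | (forall i, f i = 0 \/ Q i (f i)) /\
    forall i : {classic I}, f i != 0 -> i \in s]%classic.
  apply: sub_finite_set => f /= fQ; split=> [i|i _]; last exact: sI.
  by right.
elim: s {sI} => [|a s IH].
  apply: (@sub_finite_set _ _ [set 0]%classic); last exact: finite_set1.
  move=> f /= [_ f0]; apply: dsumP => i; apply/eqP; apply: contraT => /(f0 i).
  by rewrite in_nil.
pose cut f i := if `[< i = a >] then 0 else f i.
have cutP f : exists g : dsum X, forall i, g i = cut f i.
  apply: dsum_make; apply: sub_finite_set (dsum_finite f) => i /=.
  by rewrite /cut; case: asboolP => //; rewrite eqxx.
have [c cE] := choice cutP.
apply: (@sub_finite_set _ _ ((fun f => (f a, c f)) @^-1`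
  (([set 0] `|` Q a) `*` [set f : dsum X | (forall i, f i = 0 \/ Q i (f i)) /\
    forall i : {classic I}, f i != 0 -> i \in s]))%classic).
  move=> f /= [fQ fs]; split; first by case: (fQ a); [left|right].
  split=> i; rewrite cE /cut; case: asboolP => //; first by left.
    by rewrite eqxx.
  by move=> ia /fs; rewrite inE => /predU1P[/ia|].
apply: finite_preimage; last first.
  by apply: finite_setX => //; rewrite finite_setU; split=> //; exact: finite_set1.
move=> f g _ _ [fga cfg]; apply: dsumP => i.
have [ia|ia] := pselect (i = a); first by rewrite ia.
have : c f i = c g i by rewrite cfg.
by rewrite !cE /cut; case: asboolP.
Qed.

End DsumTheory.

Lemma dsum_map (I : Type) (X Y : I -> zmodType) (h : forall i, {additive X i -> Y i}) :
  exists F : {additive dsum X -> dsum Y}, forall f i, F f i = h i (f i).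
Proof.
have FP (f : dsum X) : exists g : dsum Y, forall i, g i = h i (f i).
  apply: dsum_make; apply: sub_finite_set (dsum_finite f) => i /=.
  by apply: contra_neq => ->; rewrite raddf0.
have [F FE] := choice FP; have [|F' F'E] := @additive_exists (dsum X) (dsum Y) F.
  by move=> f g; apply: dsumP => i; rewrite dsumBE !FE dsumBE raddfB.
by exists F' => f i; rewrite F'E FE.
Qed.

Lemma dsum_support (I : choiceType) (X : I -> zmodType) (f : dsum X) :
  exists s : seq I, uniq s /\ forall i, f i != 0 -> i \in s.
Proof.
have /finite_seqP[s sE] := dsum_finite f; exists (undup s); rewrite undup_uniq.
split=> // i fi; rewrite mem_undup; have : [set i | f i != 0]%classic i by [].
by rewrite sE.
Qed.

Section Copies.
Variables (I : choiceType) (Z : zmodType).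
Implicit Types f g : dsum (fun _ : I => Z).

Lemma single_exists i (z : Z) :
  exists f : dsum (fun _ : I => Z), forall j, f j = if j == i then z else 0.
Proof.
apply: dsum_make; apply: sub_finite_set (finite_set1 i) => j /=.
by case: (eqVneq j i) => [-> |_] //=; rewrite eqxx.
Qed.

Lemma dsum_universal (G : zmodType) (h : I -> {additive Z -> G}) :
  exists J : {additive dsum (fun _ : I => Z) -> G}, forall f (s : seq I),
    uniq s -> (forall i, f i != 0 -> i \in s) -> J f = \sum_(i <- s) h i (f i).
Proof.
pose J f := \sum_(i \in [set: I]%classic) h i (f i).
have JE f s : uniq s -> (forall i, f i != 0 -> i \in s) ->
    J f = \sum_(i <- s) h i (f i).
  move=> us sf; rewrite /J (fsbigE s) //.
    by apply: eq_bigl => i; rewrite in_setT.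
  by move=> i _; apply: contraNeq => hi; apply: sf; apply: contra_neq hi => ->;
    rewrite raddf0.
have [|J' J'E] := @additive_exists (dsum (fun _ : I => Z)) G J.
  move=> f g; have [s [us sf]] := dsum_support f; have [t [ut tg]] := dsum_support g.
  have ust := undup_uniq (s ++ t).
  rewrite !(JE _ (undup (s ++ t))) // => [||i|i].
  - by rewrite -sumrB; apply: eq_bigr => i _; rewrite dsumBE raddfB.
  - by move=> i /tg it; rewrite mem_undup mem_cat it orbT.
  - by move=> /sf it; rewrite mem_undup mem_cat it.
  - rewrite dsumBE mem_undup mem_cat => fgi.
    have [/sf ->//|/negPn/eqP fi0] := boolP (f i != 0).
    by rewrite tg ?orbT //; apply: contra_neq fgi => gi0; rewrite fi0 gi0 subrr.
by exists J' => f s us sf; rewrite J'E; apply: JE.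
Qed.

End Copies.

(** * Infinite rank *)

Lemma mulrz_additive (I : Type) (G : zmodType) (x : I -> G) :
  exists h : I -> {additive int -> G}, forall i c, h i c = x i *~ c.
Proof.
have hP i : exists h : {additive int -> G}, forall c, h c = x i *~ c.
  by apply: additive_exists => c d; rewrite mulrzBr.
by have [h hE] := choice hP; exists h.
Qed.

Lemma pair_additive (G A B : zmodType) (f : {additive G -> A}) (g : {additive G -> B}) :
  exists h : {additive G -> (A * B)%type}, forall x, h x = (f x, g x).
Proof. by apply: additive_exists => x y; rewrite !raddfB. Qed.

(* With [M] the span of the [x m], the group [E * G / M] is both a quotient   *)
(* of [G] (the [nu m] exhaust [E]) and a receptacle for an embedding of [G]   *)
(* sending [x 0] to the [n]-divisible element [z 0] of [E].                   *)
Lemma coBassian_divides (G : zmodType) (U : zmodClosed G) (Z : zmodType)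
    (x : nat -> G) (z : nat -> Z) (nu : nat -> dsum (fun _ : nat => Z)) :
    generalized_coBassian G -> extendable U (dsum (fun _ : nat => Z)) ->
    (forall e, exists m, nu m = e) ->
    (forall N (c : nat -> int), \sum_(m < N) x m *~ c m \in U ->
       forall m, (m < N)%N -> z m *~ c m = 0 /\ nu m *~ c m = 0) ->
    (forall m c, z m *~ c = 0 -> x m *~ c = 0) ->
  forall w n, z 0%N = w *+ n -> exists y, y *+ n = x 0%N.
Proof.
move=> Gco extE nu_surj xzU zx w n z0E.
have [hx hxE] := mulrz_additive x.
have [hz hzE] := mulrz_additive z.
have [hn hnE] := mulrz_additive nu.
have [J JE] := dsum_universal hx; have [f fE] := dsum_universal hn.
have [i iE] := dsum_map hz.
have [d dE] := choice (fun m : nat => single_exists m (1 : int)).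
have dS m k : d m k != 0 -> k \in [:: m].
  by rewrite dE inE; case: (k == m).
have Jd m : J (d m) = x m.
  by rewrite (JE _ [:: m]) ?big_seq1 // ?hxE ?dE ?eqxx //; apply: dS.
have fd m : f (d m) = nu m.
  by rewrite (fE _ [:: m]) ?big_seq1 // ?hnE ?dE ?eqxx //; apply: dS.
have bound (c : dsum (fun _ : nat => int)) : exists N, forall k, c k != 0 -> (k < N)%N.
  have [s [_ sc]] := dsum_support c; exists (\max_(k <- s) (k : nat)).+1 => k /sc ks.
  by rewrite ltnS (leq_bigmax_seq (F := id)).
have JU c : J c \in U -> i c = 0 /\ f c = 0.
  have [N cN] := bound c.
  have cN' k : c k != 0 -> k \in index_iota 0 N by rewrite mem_index_iota => /cN.
  rewrite (JE _ _ (iota_uniq _ _) cN') (fE _ _ (iota_uniq _ _) cN') !big_mkord.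
  under eq_bigr do rewrite hxE.
  move=> /xzU zn; split.
    apply: dsumP => k; rewrite iE hzE; have [kN|Nk] := ltnP k N; first by have [] := zn k kN.
    have [->|/cN] := eqVneq (c k) 0; first by rewrite mulr0z.
    by rewrite ltnNge Nk.
  by apply: big1 => k _; rewrite hnE; have [] := zn k (ltn_ord k).
have iJ c : i c = 0 -> J c = 0.
  move=> ic; have [s [us sc]] := dsum_support c; rewrite (JE _ _ us sc).
  by apply: big1 => k _; rewrite hxE; apply: zx; rewrite -hzE -iE ic.
(* [F] maps the span of the [x m] onto [E], and [K] is injective on it. Paired with the projection
   [pi], they give the surjection [q] and the embedding [psi]. *)
have [F FE] := extE _ J f (fun c cU => (JU c cU).2).
have [K KE] := extE _ J i (fun c cU => (JU c cU).1).
pose pi : {additive G -> Quotient.quot (im J)} := \pi_(Quotient.quot (im J)).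
have piJ c : pi (J c) = 0 by apply/quot_pi0/asboolP; exists c.
have [q qE] := pair_additive F pi; have [psi psiE] := pair_additive K pi.
have [||rho rhoK] := coBassian_retraction Gco (q := q) (psi := psi).
- move=> [e y]; have [g gy] := quot_surj y; have [m me] := nu_surj (e - F g).
  exists (g + J (d m)); rewrite qE !raddfD FE fd me piJ addr0.
  by rewrite addrC subrK /pi /= gy.
- apply: additive_inj => g; rewrite psiE => -[Kg /quot_pi0 /asboolP[c cg]].
  by move: Kg; rewrite -cg KE => /iJ.
have [e eE] := single_exists 0%N w.
(* [psi (x 0)] is [z 0] in coordinate 0, that is [n] times [(e, 0)]; the retraction carries this
   back to [G]. *)
exists (rho (e, 0)); rewrite -raddfMn -(rhoK (x 0%N)) psiE -Jd KE piJ pair_mulrn mul0rn.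
congr (rho (_, _)); apply: dsumP => k; rewrite dsumMnE iE hzE eE dE.
by case: eqP => [->|_]; rewrite ?mul0rn ?mulr0z // mulr1z z0E.
Qed.

Lemma sequence_exists (T : Type) (P : seq T -> T -> Prop) :
  (forall s, exists y, P s y) -> exists x : nat -> T, forall m, P (mkseq x m) (x m).
Proof.
move=> /choice[f fP].
pose pre := fix pre m := if m is k.+1 then rcons (pre k) (f (pre k)) else [::].
exists (f \o pre) => m; suff -> : mkseq (f \o pre) m = pre m by apply: fP.
by elim: m => // m IH; rewrite mkseqS IH.
Qed.

(** The order of [y] modulo [U] and the span of [s] is a multiple of [o]. Since only 0 is divisible
    by 0, [o = 0] expresses infinite order. *)
Definition independent_over (G : zmodType) (U : zmodClosed G) (o : nat) (s : seq G) (y : G) :=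
  forall (c : nat -> int) (d : int),
    y *~ d - \sum_(i < size s) s`_i *~ c i \in U -> (o %| d)%Z.

Lemma independent_sums (G : zmodType) (U : zmodClosed G) (x : nat -> G) (o : nat -> nat) :
    (forall m, x m *+ o m = 0) ->
    (forall m, independent_over U (o m) (mkseq x m) (x m)) ->
  forall N (c : nat -> int), \sum_(i < N) x i *~ c i \in U ->
    forall m, (m < N)%N -> (o m %| c m)%Z.
Proof.
move=> xo xind; elim=> // N IH c; rewrite big_ord_recr /= => sU.
have oN : (o N %| c N)%Z.
  apply: (xind N (fun i => - c i)); rewrite size_mkseq.
  under eq_bigr => i _ do rewrite nth_mkseq // mulrNz.
  by rewrite sumrN opprK addrC.
move=> m; rewrite ltnS leq_eqVlt => /predU1P[-> //|mN]; apply: IH mN.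
suff <- : \sum_(i < N) x i *~ c i + x N *~ c N = \sum_(i < N) x i *~ c i by [].
by have /dvdzP[b ->] := oN; rewrite mulrC mulrzA -pmulrn xo mul0rz addr0.
Qed.

Lemma integer_kernel k n (C : 'I_k -> 'I_n -> int) : (n < k)%N ->
  exists a : 'I_k -> int, (exists j, a j != 0) /\
    forall i, \sum_j a j * C j i = 0.
Proof.
move=> nk; pose M : 'M[rat]_(k, n) := \matrix_(j, i) (C j i)%:~R.
have kn0 : kermx M != 0.
  rewrite -mxrank_eq0 mxrank_ker subn_eq0 -ltnNge.
  exact: leq_ltn_trans (rank_leq_col M) nk.
have [r rn0] : exists r, row r (kermx M) != 0.
  apply: contrapT => nr; move/eqP: kn0; apply; apply/row_matrixP => r.
  by rewrite row0; apply/eqP; apply: contra_notT nr => ?; exists r.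
pose v := row r (kermx M); have vM : v *m M = 0 by rewrite -row_mul mulmx_ker row0.
have [j vj] : exists j, v 0 j != 0.
  by move/eqP/rowP: rn0 => /existsNP[j]; rewrite [in RHS]mxE => /eqP vj; exists j.
(* The rational relation [v] multiplied by the product of all its denominators. *)
pose a j := numq (v 0 j) * \prod_(i | i != j) denq (v 0 i).
have aE j' : (a j')%:~R = v 0 j' * (\prod_i denq (v 0 i))%:~R.
  by rewrite (bigD1 j') //= /a !intrM mulrA numqE.
exists a; split.
  exists j; rewrite mulf_neq0 ?numq_eq0 //; apply/prodf_neq0 => i _.
  exact: denq_neq0.
move=> i; apply: (@intr_inj rat); rewrite rmorph_sum /=.
under eq_bigr => j' _ do rewrite intrM aE mulrAC.
rewrite -mulr_suml; have /rowP/(_ i) := vM; rewrite !mxE => vMi.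
suff -> : \sum_j' v 0 j' * (C j' i)%:~R = 0 by rewrite mul0r.
by rewrite -[RHS]vMi; apply: eq_bigr => j' _; rewrite [M _ _]mxE.
Qed.

Lemma quot_sum (G : zmodType) (H : zmodClosed G) k (g : 'I_k -> G) (c : 'I_k -> int) :
  \sum_i \pi_(Quotient.quot H) (g i) *~ c i =
  \pi_(Quotient.quot H) (\sum_i g i *~ c i).
Proof. by rewrite raddf_sum; apply: eq_bigr => i _; rewrite raddfMz. Qed.

(** If every [y] depended on [s] modulo torsion, more than [size s] elements would be dependent by
    [integer_kernel], and the rank would be finite. *)
Lemma infinite_rank_extend (G : zmodType) (s : seq G) :
    ~ finite_rank (Quotient.quot (torsion (X := G))) ->
  exists y, independent_over (torsion (X := G)) 0 s y.
Proof.
move=> infr; apply: contrapT => noy; apply: infr.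
have dep y : exists cd : (nat -> int) * int, cd.2 != 0 /\
    y *~ cd.2 - \sum_(i < size s) s`_i *~ cd.1 i \in torsion (X := G).
  apply: contrapT => nocd; apply: noy; exists y => c d cdT.
  rewrite dvd0z; apply: contra_notT nocd => d0.
  by exists (c, d).
have [e eP] := choice dep.
have bound k (v : 'I_k -> Quotient.quot (torsion (X := G))) : independent v -> (k <= size s)%N.
  move=> vind; rewrite leqNgt; apply/negP => sk.
  have [g gv] := choice (fun j => quot_surj (v j)).
  have [a [[j aj] aC]] := integer_kernel (fun j i => (e (g j)).1 (nat_of_ord i)) sk.
  suff : a j * (e (g j)).2 = 0.
    by move/eqP; rewrite mulf_eq0 (negbTE aj) (negbTE (eP (g j)).1).
  apply: (vind (fun i => a i * (e (g i)).2) _ j).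
  under eq_bigr => i _ do rewrite -gv.
  rewrite quot_sum; apply/quot_pi0.
  have -> : \sum_i g i *~ (a i * (e (g i)).2) =
      \sum_i (g i *~ (e (g i)).2 - \sum_(l < size s) s`_l *~ (e (g i)).1 l) *~ a i.
    under [RHS]eq_bigr => i _ do rewrite mulrzBl -mulrzA [_ * a i]mulrC.
    rewrite sumrB -[LHS]subr0; congr (_ - _).
    under eq_bigr => i _ do rewrite mulrz_suml.
    rewrite exchange_big big1 //= => l _.
    under eq_bigr => i _ do rewrite -mulrzA mulrC.
    by rewrite -mulrz_sumr aC mulr0z.
  by apply: rpred_sum => i _; apply: rpredMz; exact: (eP (g i)).2.
pose Q r := `[< exists v : 'I_r -> Quotient.quot (torsion (X := G)), independent v >].
have [||r /asboolP Qr rmax] := @ex_maxnP Q (size s).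
- by exists 0%N; apply/asboolP; exists (fun=> 0) => c _ [].
- by move=> r /asboolP[v /bound].
by exists r; split=> // k v vind; apply: rmax; apply/asboolP; exists v.
Qed.

Lemma torsion_divz (G : zmodType) (x : G) d :
  d != 0 -> x *~ d \in torsion (X := G) -> x \in torsion (X := G).
Proof.
move=> d0 /asboolP[n n0 xdn]; apply/asboolP; exists (`|d| * n)%N.
  by rewrite muln_gt0 absz_gt0 d0.
case: d {d0} xdn => m; first by rewrite -pmulrn -mulrnA.
by rewrite NegzE mulrNz mulNrn -pmulrn -mulrnA => /eqP; rewrite oppr_eq0 => /eqP.
Qed.

Lemma copies_enumeration (T : countType) (Z : zmodType) (zeta : T -> Z) :
    (forall z, exists t, zeta t = z) ->
  exists nu : nat -> dsum (fun _ : nat => Z), forall e, exists m, nu m = e.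
Proof.
move=> zeta_surj.
have [f fE] : exists f : seq T -> dsum (fun _ : nat => Z), forall s m,
    f s m = nth 0 (map zeta s) m.
  have fP (s : seq T) : exists f : dsum (fun _ : nat => Z), forall m,
      f m = nth 0 (map zeta s) m.
    apply: dsum_make; apply: (@sub_finite_set _ _ `I_(size s)) => // m /=.
    by apply: contraR; rewrite -leqNgt => sm; rewrite nth_default ?size_map.
  by have [f fP'] := choice fP; exists f.
have [t tE] := choice zeta_surj.
exists (fun m => f (odflt [::] (unpickle m))) => e.
have [s [_ se]] := dsum_support e; set N := (\max_(k <- s) (k : nat)).+1.
exists (pickle (mkseq (t \o e) N)); rewrite pickleK /=; apply: dsumP => k.
rewrite fE /mkseq -map_comp -/(mkseq _ _).
have [kN|Nk] := ltnP k N; first by rewrite nth_mkseq //= tE.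
rewrite nth_default ?size_mkseq //; apply/esym/eqP; apply: contraLR Nk.
by move=> /se ks; rewrite -ltnNge ltnS (leq_bigmax_seq (F := id)).
Qed.

(** A non-torsion [x] starts an independent sequence, and [coBassian_divides] applies with every
    [z m] equal to 1 in the rationals. A torsion element is a difference of two non-torsion ones. *)
Lemma infinite_rank_divisible (G : zmodType) :
    generalized_coBassian G -> ~ finite_rank (Quotient.quot (torsion (X := G))) ->
  divisible G.
Proof.
move=> Gco infr n g n0; pose T : zmodClosed G := torsion (X := G).
have [nu nuP] : exists nu : nat -> dsum (fun _ : nat => rat), forall e, exists m, nu m = e.
  by apply: (@copies_enumeration _ rat id) => q; exists q.
have torsion_free_case x : x \notin T -> exists y, y *+ n = x.
  move=> xT.
  have [|X XP] := @sequence_exists G (fun s y => (s = [::] -> y = x) /\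
    independent_over T 0 s y).
    case=> [|a s].
      exists x; split=> // c d; rewrite /= big_ord0 subr0 dvd0z; apply: contraTT.
      by move=> d0; apply: contra xT; apply: torsion_divz.
    by have [y yP] := infinite_rank_extend (a :: s) infr; exists y.
  have ind := @independent_sums G T X (fun=> 0%N) (fun m => mulr0n (X m)) (fun m => (XP m).2).
  rewrite -((XP 0%N).1 erefl).
  apply: (@coBassian_divides G T rat X (fun=> 1) nu Gco _ nuP _ _ (n%:R^-1)).
  - apply/extendable_divisible/dsum_divisible => _ k q k0; exists (q / k%:R).
    by rewrite -[LHS]mulr_natr divfK // pnatr_eq0 -lt0n.
  - by move=> N c /ind cP m /cP; rewrite dvd0z => /eqP ->; rewrite !mulr0z.
  - by move=> m c /eqP; rewrite intr_eq0 => /eqP ->; rewrite mulr0z.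
  - by rewrite -[RHS]mulr_natr mulVf // pnatr_eq0 -lt0n.
have [gT|/torsion_free_case //] := boolP (g \in T).
have [x xind] := infinite_rank_extend [::] infr.
have xT : x \notin T.
  apply/negP => xT; have := xind (fun=> 0) 1.
  by rewrite big_ord0 subr0 mulr1z dvd0z => /(_ xT).
have [|y yn] := torsion_free_case (g + x); first by rewrite rpredDl.
have [z zn] := torsion_free_case x xT.
by exists (y - z); rewrite mulrnBl yn zn addrK.
Qed.

(** * The groups Z(p^a) *)

Lemma mulrn_modn (G : zmodType) (y : G) n m : y *+ n = 0 -> y *+ (m %% n) = y *+ m.
Proof.
by move=> yn; rewrite [in RHS](divn_eq m n) mulrnDr mulnC mulrnA yn mul0rn add0r.
Qed.

Lemma ordinal_generator n : exists u : 'I_n.+1,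
  [/\ forall z : 'I_n.+1, z = u *+ z, forall m, u *+ m = 0 -> (n.+1 %| m)%N &
    nat_of_ord u = (1 %% n.+1)%N].
Proof.
have E m : (inZp 1 : 'I_n.+1) *+ m = inZp m.
  by rewrite Zp_mulrn; apply: val_inj; rewrite /= modnMml mul1n.
exists (inZp 1); split=> // [z|m]; rewrite E; first by rewrite valZpK.
by move/(congr1 val) => /= mn; apply/eqP.
Qed.

Lemma ordinal_hom (G : zmodType) (y : G) n : y *+ n.+1 = 0 ->
  exists h : {additive 'I_n.+1 -> G}, forall z : 'I_n.+1, h z = y *+ z.
Proof.
move=> yn; apply: additive_exists => z w /=.
rewrite mulrn_modn // mulrnDr mulrn_modn // mulrnBr; last exact: ltnW.
by rewrite yn sub0r.
Qed.

Section Cyclic.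
Variables (p : nat) (p_pr : prime p).

Lemma pexp_gt0 k : (0 < p ^ k)%N.
Proof. by rewrite expn_gt0 prime_gt0. Qed.

Lemma cyclic_exponent k (z : Zpow p (Some k)) : z *+ p ^ k = 0.
Proof.
suff H m : m = (p ^ k).-1.+1 -> z *+ m = 0 by apply: H; rewrite prednK ?pexp_gt0.
by move=> ->; rewrite Zp_mulrn; apply: val_inj; rewrite /= modnMl.
Qed.

Lemma cyclic_generator k : exists u : Zpow p (Some k),
  [/\ forall z, exists c : nat, z = u *+ c,
    forall c : int, u *~ c = 0 -> ((p ^ k)%N %| c)%Z &
   forall (G : zmodType) (y : G), y *+ p ^ k = 0 ->
     exists h : {additive Zpow p (Some k) -> G}, h u = y].
Proof.
have [u [uz um u1]] := ordinal_generator (p ^ k).-1.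
exists u; split=> [z|c uc|G y yk]; first by exists z; rewrite -uz.
  rewrite dvdzE /= -[(p ^ k)%N]prednK ?pexp_gt0 //; apply: um.
  case: c uc => m; first by rewrite pmulrn.
  by rewrite NegzE mulrNz abszN => /eqP; rewrite oppr_eq0 => /eqP.
have [|h hE] := @ordinal_hom G y (p ^ k).-1; first by rewrite prednK ?pexp_gt0.
by exists h; rewrite hE u1 mulrn_modn ?mulr1n // prednK ?pexp_gt0.
Qed.

Lemma cyclic_root k m (z : Zpow p (Some k)) : (m < k)%N ->
  z *+ p ^ m = 0 -> exists d, d *+ p = z.
Proof.
move=> mk; have [u [uz um _]] := cyclic_generator k; have [c ->] := uz z.
rewrite -mulrnA => uc0; have /um : u *~ (c * p ^ m)%N = 0 by rewrite -pmulrn.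
have -> : (p ^ k = p ^ (k - m.+1).+1 * p ^ m)%N by rewrite -expnD addSnnS subnK.
move=> pc; have {pc} : (p ^ (k - m.+1).+1 %| c)%N.
  by move: pc; rewrite dvdzE /= dvdn_pmul2r ?pexp_gt0.
rewrite expnS => /dvdnP[b ->].
by exists (u *+ (b * p ^ (k - m.+1))); rewrite -mulrnA -mulnA [(_ * p)%N]mulnC.
Qed.

Lemma prufer_primary (z : prufer p) : exists t, z *+ p ^ t = 0.
Proof.
case: z => z zp; have /asboolP[t zt] := zp; exists t.
by apply: val_inj; rewrite raddfMn /= zt.
Qed.

Lemma prufer_element (r : rat) : (exists t, r *+ p ^ t \is a Num.int) ->
  exists z : prufer p, val z = \pi_(Quotient.quot integers) r.
Proof.
move=> [t rt].
have zP : \pi_(Quotient.quot integers) r \in primary (X := Quotient.quot integers) p.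
  by apply/asboolP; exists t; rewrite -raddfMn; apply/quot_pi0.
by exists (Subgroup zP).
Qed.

Lemma prufer_lift (z : prufer p) : exists r : rat,
  val z = \pi_(Quotient.quot integers) r /\ exists t, r *+ p ^ t \is a Num.int.
Proof.
have [r rz] := quot_surj (val z); exists r; split=> //.
have [t zt] := prufer_primary z; exists t; apply/(quot_pi0 integers).
by rewrite raddfMn /= rz -raddfMn zt raddf0.
Qed.

Lemma prufer_divisible : divisible (prufer p).
Proof.
move=> n z n0; have [r [rz [t rt]]] := prufer_lift z.
have [d [m [pm nE]]] : exists d m, coprime p m /\ n = (m * p ^ d)%N.
  by have [m pm nE] := pfactor_coprime p_pr n0; exists (logn p n), m.
have [|y yz] := @prufer_element (r / (p ^ d)%:R).
  exists (d + t)%N; rewrite expnD mulrnA -[X in X *+ _]mulr_natr divfK //.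
  by rewrite pnatr_eq0 -lt0n pexp_gt0.
have yd : y *+ p ^ d = z.
  apply: val_inj; rewrite raddfMn /= yz -raddfMn rz /=.
  by rewrite -[X in \pi_ _ X]mulr_natr divfK // pnatr_eq0 -lt0n pexp_gt0.
have [s ys] := prufer_primary y.
have [|c yc] := @coprime_divide _ y (p ^ s) m _ ys; first exact: coprimeXl.
by exists (y *~ c); rewrite nE mulrnA -yc.
Qed.

Lemma prufer_enumeration : exists zeta : rat -> prufer p, forall z, exists r, zeta r = z.
Proof.
have zP (r : rat) : exists z : prufer p, (exists t, r *+ p ^ t \is a Num.int) ->
    val z = \pi_(Quotient.quot integers) r.
  have [/prufer_element[z zr]|nr] := pselect (exists t, r *+ p ^ t \is a Num.int).
    by exists z.
  by exists 0.
have [zeta zetaP] := choice zP; exists zeta => z.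
have [r [rz rt]] := prufer_lift z; exists r; apply: val_inj.
by rewrite (zetaP _ rt) rz.
Qed.

Lemma prufer_cyclic e : exists u : prufer p,
  [/\ u *+ p ^ e = 0, forall c : int, u *~ c = 0 -> ((p ^ e)%N %| c)%Z &
    forall z, z *+ p ^ e = 0 -> exists c : int, z = u *~ c].
Proof.
have pe0 : (p ^ e)%:R != 0 :> rat by rewrite pnatr_eq0 -lt0n pexp_gt0.
have uE : ((p ^ e)%:R^-1 : rat) *+ p ^ e = 1 by rewrite -[LHS]mulr_natr mulVf.
have [|u uu] := @prufer_element (p ^ e)%:R^-1; first by exists e; rewrite uE.
exists u; split.
- by apply: val_inj; rewrite raddfMn /= uu -raddfMn uE; apply/quot_pi0.
- move=> c /(congr1 val); rewrite raddfMz /= uu -raddfMz => /quot_pi0 /intrP[b bE].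
  apply/dvdzP; exists b; apply: (@intr_inj rat).
  by rewrite intrM -[(b)%:~R]bE -[X in X * _]mulrzl -mulrA mulVf ?mulr1.
move=> z; have [r [rz _]] := prufer_lift z.
move=> /(congr1 val); rewrite raddfMn /= rz -raddfMn => /quot_pi0 /intrP[b bE].
exists b; apply: val_inj; rewrite raddfMz /= uu -raddfMz rz; congr (\pi_ _ _).
by rewrite -[RHS]mulrzl -bE -[r *+ _]mulr_natr mulfK.
Qed.

End Cyclic.

(** * The torsion of a co-Bassian group *)

Lemma mulrz_dvd (G : zmodType) (y : G) (o : nat) (c : int) :
  y *+ o = 0 -> (o %| c)%Z -> y *~ c = 0.
Proof. by move=> yo /dvdzP[b ->]; rewrite mulrC mulrzA -pmulrn yo mul0rz. Qed.

Definition zspan (G : zmodType) (s : seq G) : set G :=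
  [set g | exists c : nat -> int, g = \sum_(i < size s) s`_i *~ c i]%classic.

Lemma finite_zspan (G : zmodType) (s : seq G) :
  (forall x, x \in s -> x \in torsion (X := G)) -> finite_set (zspan s).
Proof.
elim: s => [|x s IH] sT.
  apply: (@sub_finite_set _ _ [set 0]%classic); last exact: finite_set1.
  by move=> g [c ->]; rewrite big_ord0.
have /asboolP[o o0 xo] := sT x (mem_head _ _).
apply: (@sub_finite_set _ _ [set (x *+ i) + h | i in `I_o & h in zspan s]%classic).
  move=> g [c ->]; rewrite big_ord_recl /=.
  exists `|(c 0%N %% o)%Z|%N => /=.
    by rewrite -ltz_nat gez0_abs ?ltz_pmod ?modz_ge0 // -?lt0n // lt0r_neq0.
  exists (\sum_(i < size s) s`_i *~ c i.+1); first by exists (c \o S).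
  congr (_ + _); rewrite pmulrn gez0_abs ?modz_ge0 ?lt0r_neq0 //.
  rewrite [in RHS](divz_eq (c 0%N) o) [RHS]mulrzDr [X in _ = X + _](mulrz_dvd xo) ?add0r //.
  exact: dvdz_mull.
apply: finite_image2 => //; apply: IH => y ys; apply: sT.
by rewrite inE ys orbT.
Qed.

(** The gcd of [d] and [p^(e+1)] is some [p^f] with [f <= e]; a Bezout relation multiplied by
    [p^(e-f)] gives [a]. *)
Lemma dvdz_pexp_mul (G : zmodType) (y : G) p e (d : int) : prime p ->
  y *+ p ^ e.+1 = 0 -> ~ ((p ^ e.+1)%N %| d)%Z -> exists a, y *~ d *~ a = y *+ p ^ e.
Proof.
move=> pp ye pd.
have [f fe fE] : exists2 f, (f <= e.+1)%N & gcdn `|d| (p ^ e.+1) = (p ^ f)%N.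
  by apply/(dvdn_pfactor _ _ pp); apply: dvdn_gcdr.
have {}fe : (f <= e)%N.
  rewrite -ltnS ltn_neqAle fe andbT; apply/eqP => fe'; apply: pd.
  by rewrite dvdzE /= -fe' -fE dvdn_gcdl.
have [a [b ab]] := Bezoutz d (p ^ e.+1)%N.
exists (a * (p ^ (e - f))%N%:Z); rewrite -mulrzA mulrA [d * a]mulrC.
have -> : a * d = (p ^ f)%N%:Z - b * (p ^ e.+1)%N 
  by move: ab; rewrite /gcdz /= fE => <-; rewrite addrK.
rewrite mulrBl -PoszM -expnD subnKC // mulrzBr -pmulrn.
by rewrite -mulrA mulrC -!mulrA mulrzA -pmulrn ye mul0rz subr0.
Qed.

(* Choosing [p ^ e m * X m] outside the finite span of the previous terms      *)
(* modulo [U] makes the cyclic groups generated by the [X m] independent.     *)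
Lemma torsion_sequence (G : zmodType) (U : zmodClosed G) p (e : nat -> nat) (x : G) :
    prime p -> x *+ p ^ (e 0%N).+1 = 0 -> x *+ p ^ e 0%N \notin U ->
    (forall m (M : set G), finite_set M ->
      exists y, y *+ p ^ (e m.+1).+1 = 0 /\ forall h, M h -> y *+ p ^ e m.+1 - h \notin U) ->
  exists X : nat -> G, [/\ X 0%N = x, forall m, X m *+ p ^ (e m).+1 = 0 &
    forall N (c : nat -> int), \sum_(i < N) X i *~ c i \in U ->
      forall m, (m < N)%N -> ((p ^ (e m).+1)%N %| c m)%Z].
Proof.
move=> pp x0 xU step.
(* A next term is demanded after every list, but only lists of torsion elements have a finite span;
   hence the guard. *)
pose P (s : seq G) y := (s = [::] -> y = x) /\
  ((forall x, x \in s -> x \in torsion (X := G)) ->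
   y *+ p ^ (e (size s)).+1 = 0 /\ forall h, zspan s h -> y *+ p ^ e (size s) - h \notin U).
have [|X XP] := @sequence_exists G P.
  case=> [|a s].
    by exists x; split=> // _; split=> // h [c ->]; rewrite big_ord0 subr0.
  have [/finite_zspan sfin|ns] := pselect (forall x, x \in a :: s -> x \in torsion (X := G)).
    by have [y yP] := step (size s) _ sfin; exists y.
  by exists 0.
have XT m : forall y, y \in mkseq X m -> y \in torsion (X := G).
  elim: m => [//|m IH] y; rewrite mkseqS mem_rcons inE => /predU1P[->|/IH //].
  have [] := (XP m).2 IH; rewrite size_mkseq => Xm _.
  by apply/asboolP; exists (p ^ (e m).+1)%N; rewrite // expn_gt0 prime_gt0.
have Xm m : X m *+ p ^ (e m).+1 = 0.
  by have [] := (XP m).2 (XT m); rewrite size_mkseq.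
exists X; split=> //; first exact: (XP 0%N).1.
apply: (@independent_sums _ _ _ (fun m => p ^ (e m).+1)%N) => // m c d cdU.
apply: contrapT => /(dvdz_pexp_mul pp (Xm m))[a aE].
have [_ nU] := (XP m).2 (XT m).
have ca : zspan (mkseq X m)
    (\sum_(i < size (mkseq X m)) (mkseq X m)`_i *~ (c i * a)) by exists (fun i => c i * a).
have := nU _ ca; rewrite size_mkseq => /negP; apply.
rewrite (_ : \sum_(i < m) _ = (\sum_(i < m) (mkseq X m)`_i *~ c i) *~ a); last first.
  by rewrite mulrz_suml; apply: eq_bigr => i _; rewrite mulrzA.
by move: cdU; rewrite size_mkseq -aE -mulrzBl => /rpredMz; apply.
Qed.

(** The socle of [p^n T_p]. *)
Definition psocle (G : zmodType) (p n : nat) : set G :=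
  [set s | s *+ p = 0 /\ exists y, y *+ p ^ n = s]%classic.
Arguments psocle : clear implicits.

Lemma dsum_primary (I : choiceType) (X : I -> zmodType) p :
    (forall i (x : X i), exists t, x *+ p ^ t = 0) ->
  forall f : dsum X, exists t, f *+ p ^ t = 0.
Proof.
move=> Xp f; have [t tP] := choice (fun i => Xp i (f i)); have [s [_ sf]] := dsum_support f.
exists (\max_(i <- s) t i); apply: dsumP => i; rewrite dsumMnE.
have [->|/sf si] := eqVneq (f i) 0; first by rewrite mul0rn.
have le : (t i <= \max_(i <- s) t i)%N 
    by rewrite (leq_bigmax_seq (F := fun i => t i)).
by rewrite -(subnKC le) expnD mulrnA tP mul0rn.
Qed.

Section TorsionPart.
Variables (G : zmodType) (p : nat).
Hypotheses (Gco : generalized_coBassian G) (pp : prime p).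

Lemma coBassian_unbounded (x : G) k : x *+ p ^ k.+1 = 0 -> x *+ p ^ k != 0 ->
  (forall n, infinite_set (psocle G p n)) -> exists y, y *+ p = x.
Proof.
move=> xk xk0 inf.
have [U UP] := trivial_subgroup G.
have [zeta zetaP] := prufer_enumeration p.
have [nu nuP] := copies_enumeration zetaP.
have [t tP] := choice (dsum_primary (I := nat) (X := fun=> prufer p) (fun=> @prufer_primary p)).
(* The order [p^(e m + 1)] of the [m]-th term must annihilate the element of [E] it is sent to.
   Index 0 is reserved for [x], so the enumeration of [E] is shifted by one. *)
pose e m := if m is l.+1 then t (nu l) else k.
have [||X [X0 Xe Xind]] := @torsion_sequence G U p e x pp xk.
- by apply/negP => /UP /eqP; rewrite (negbTE xk0).
- move=> m M Mfin.
  have /infinite_setN0[s [[sp [y ys]] sM]] := infinite_setD (inf (e m.+1)) Mfin.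
  exists y; split; first by rewrite expnSr mulrnA ys.
  by move=> h Mh; apply/negP => /UP /eqP; rewrite ys subr_eq0 => /eqP sh; rewrite sh in sM.
have [z zP] := choice (fun m => prufer_cyclic pp (e m).+1).
have [w wz] := prufer_divisible pp (z 0%N) (prime_gt0 pp).
pose nu' m := if m is l.+1 then nu l else 0.
rewrite -X0; apply: (@coBassian_divides G U _ X z nu' Gco _ _ _ _ w) => //.
- by apply/extendable_divisible/dsum_divisible => _; apply: prufer_divisible.
- by move=> f; have [m <-] := nuP f; exists m.+1.
- move=> N c /Xind cP m /cP pc; have [zm _ _] := zP m.
  split; first exact: mulrz_dvd zm pc.
  case: m pc {zm} => [|m] pc; first by rewrite mul0rz.
  by apply: mulrz_dvd pc; rewrite /= expnSr mulrnA tP mul0rn.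
- by move=> m c; have [_ zc _] := zP m; move=> /zc; apply: mulrz_dvd.
Qed.

(** Here [E] is a sum of copies of [Z(p^(n+1))]. The element [x], of order [p^(k+1)], is sent to
    [p^(n-k) u], which is divisible by [p] because [k < n]. *)
Lemma coBassian_bounded (x : G) k n :
    x *+ p ^ k.+1 = 0 -> (k < n)%N -> (forall g, x *+ p ^ k != g *+ p ^ n.+1) ->
    infinite_set (psocle G p n) -> finite_set (psocle G p n.+1) ->
  exists y, y *+ p = x.
Proof.
move=> xk kn xn inf fin.
have [U UP] := multiples_subgroup G (p ^ n.+1).
have [|nu nuP] := @copies_enumeration 'I_(p ^ n.+1).-1.+1 (Zpow p (Some n.+1)) id.
  by move=> z; exists z.
have [u [_ um _]] := cyclic_generator pp n.+1.
pose e m := if m is _.+1 then n else k.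
have [||X [X0 Xe Xind]] := @torsion_sequence G U p e x pp xk.
- by apply/negP => /UP[g /eqP]; apply/negP.
- move=> m M Mfin.
  (* The elements of [psocle G p n] congruent to [h] modulo [U] lie in one coset of the finite
     [psocle G p n.+1], so finitely many [h] exclude only finitely many of them. *)
  have rP h : exists r, (exists2 s, psocle G p n s & s - h \in U) ->
      psocle G p n r /\ r - h \in U.
    by have [[s sn sh]|ns] := pselect (exists2 s, psocle G p n s & s - h \in U);
      [exists s|exists 0].
  have [r rE] := choice rP.
  have /infinite_setN0[s [[sp [y ys]] sM]] :=
    infinite_setD inf (finite_image2 (fun h t => r h + t) Mfin fin).
  exists y; split; first by rewrite expnSr mulrnA ys.
  move=> h Mh; apply/negP; rewrite ys => shU; apply: sM.
  have [|[rp _] rh] := rE h; first by exists s => //; split=> //; exists y.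
  exists h => //; exists (s - r h); last by rewrite addrC subrK.
  split; first by rewrite mulrnBl sp rp subr0.
  have /UP[g ->] : s - r h \in U.
    have -> : s - r h = (s - h) - (r h - h) by rewrite opprB addrA subrK.
    exact: rpredB.
  by exists g.
pose z m := if m is _.+1 then u else u *+ p ^ (n - k).
pose nu' m := if m is l.+1 then nu l else 0.
rewrite -X0; apply: (@coBassian_divides G U _ X z nu' Gco _ _ _ _ (u *+ p ^ (n - k).-1)).
- apply: (extendable_homogeneous (k := n) pp) => [f|f fn|g].
  + by apply: dsumP => i; rewrite dsumMnE cyclic_exponent.
  + apply: dsum_root => i; apply: (cyclic_root pp (ltnSn n)).
    by have := dsumMnE f (p ^ n) i; rewrite fn => <-.
  + by apply/UP; exists g.
- by move=> f; have [m <-] := nuP f; exists m.+1.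
- move=> N c /Xind cP m /cP; case: m => [|m] pc.
    split; last by rewrite mul0rz.
    apply: mulrz_dvd pc; rewrite /z -mulrnA -expnD addnS subnK; last exact: ltnW.
    exact: cyclic_exponent.
  split; apply: mulrz_dvd pc; first exact: cyclic_exponent.
  by apply: dsumP => i; rewrite dsumMnE cyclic_exponent.
- case=> [|m] c; last by move/um; apply: mulrz_dvd.
  have nE : (p ^ n.+1 = p ^ (n - k) * p ^ k.+1)%N by rewrite -expnD addnS subnK // ltnW.
  rewrite /z pmulrn -mulrzA => /um; rewrite {1}nE PoszM.
  by rewrite dvdz_mul2l ?eqz_nat -?lt0n ?pexp_gt0 //; apply: mulrz_dvd.
- by rewrite /z -mulrnA -expnSr prednK // subn_gt0.
Qed.

(* Intrinsic form of generalized finite p-rank: the first case corresponds to *)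
(* [alpha_1 = oo]; otherwise [k] is the (truncated) predecessor of [alpha_1]. *)
Definition bounded_or_divisible (G : zmodType) p :=
  (forall x, x \in primary (X := G) p -> exists y, y *+ p = x) \/
  exists k, (forall x : G, x *+ p ^ k = 0 -> exists y, y *+ p = x) /\
    finite_set (psocle G p k.+1).

Lemma psocleS n : (psocle G p n.+1 `<=` psocle G p n)%classic.
Proof. by move=> s [sp [y ys]]; split=> //; exists (y *+ p); rewrite -mulrnA -expnS. Qed.

Lemma coBassian_bounded_or_divisible : bounded_or_divisible G p.
Proof.
have [|] := pselect (forall x, x \in primary (X := G) p -> exists y, y *+ p = x); first by left.
move=> /existsNP[x0 /not_implyP[/asboolP[t0 x0t] x0p]]; right.
pose bad k := `[< exists x : G, x *+ p ^ k = 0 /\ ~ exists y, y *+ p = x >].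
have exbad : exists k, bad k by exists t0; apply/asboolP; exists x0.
case: (ex_minnP exbad) => -[|k] /asboolP[x [xk xp]] kmin.
  by case: xp; exists 0; rewrite mul0rn -xk mulr1n.
have kroot (y : G) : y *+ p ^ k = 0 -> exists y', y' *+ p = y.
  move=> yk; apply: contrapT => yp; have := kmin k; rewrite ltnn => bk.
  by apply/notF/bk/asboolP; exists y.
exists k; split=> //; apply: contrapT => inf; apply: (xp).
(* Otherwise [x - p g] would be killed by [p^k], hence divisible by [p] by minimality of [k], and so
   would [x]. *)
have xgk g : x *+ p ^ k != g *+ p *+ p ^ k.
  apply/eqP => xg; have [|h hp] := kroot (x - g *+ p); first by rewrite mulrnBl xg subrr.
  by apply: xp; exists (h + g); rewrite mulrnDl hp subrK.
have [infn|/existsNP[n0 finn0]] := pselect (forall n, infinite_set (psocle G p n)).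
  apply: (coBassian_unbounded xk) => //; apply: contra (xgk 0) => /eqP ->.
  by rewrite !mul0rn.
pose fin n := `[< finite_set (psocle G p (k.+1 + n)) >].
have exfin : exists n, fin n.
  exists n0; apply/asboolP; apply: sub_finite_set (contrapT finn0).
  by elim: (k.+1) => // m IH s /psocleS /IH.
case: (ex_minnP exfin) => -[|m] /asboolP finm mmin.
  by case: inf; rewrite addn0 in finm.
apply: (coBassian_bounded xk (n := k.+1 + m)).
- by rewrite addSn ltnS leq_addr.
- move=> g; have := xgk (g *+ p ^ m.+1).
  by rewrite -!mulrnA -?mulnA -expnS -expnD [(m.+1 + _)%N]addnC addnS.
- move=> finm'; suff : (m.+1 <= m)%N by rewrite ltnn.
  exact/mmin/asboolP.
- by rewrite -addnS.
Qed.

End TorsionPart.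

(** * Splitting off homogeneous summands *)

Definition generated (G : zmodType) (A : set G) (U : zmodClosed G) (x : G) : Prop :=
  forall W : zmodClosed G, (forall a, A a -> a \in W) -> {subset U <= W} -> x \in W.

Lemma generated_sub (G : zmodType) (A B : set G) U x :
  (A `<=` B)%classic -> generated A U x -> generated B U x.
Proof. by move=> AB Ax W BW; apply: Ax => a /AB /BW. Qed.

Lemma prime_mulz_in (G : zmodType) (W : zmodClosed G) p (x : G) c :
  prime p -> x *+ p = 0 -> ~ (p %| c)%Z -> x *~ c \in W -> x \in W.
Proof.
move=> pp xp pc xcW; have [a [b ab]] := prime_bezout pp pc.
rewrite -[x]mulr1z -ab mulrzDr [a * _]mulrC [b * _]mulrC !mulrzA -pmulrn xp.
by rewrite mul0rz add0r rpredMz.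
Qed.

(** Linear algebra over the field with [p] elements: Zorn gives a maximal subset of [S] independent
    modulo [U]. *)
Lemma generated_basis (G : zmodType) p (S : set G) (U : zmodClosed G) :
    prime p -> (forall s, S s -> s *+ p = 0) ->
  exists B : set G, [/\ (B `<=` S)%classic,
    forall b, B b -> ~ generated (B `\ b) U b & forall s, S s -> generated B U s].
Proof.
move=> pp Sp.
pose P (B : set G) := (B `<=` S)%classic /\ forall b, B b -> ~ generated (B `\ b)%classic U b.
have [F FP Ftot|B [[BS Bind] Bmax]] := @Zorn_bigcup G P.
  split=> [x [C FC Cx]|b [C0 FC0 C0b]]; first exact: (FP C FC).1.
  have chain C D : F C -> F D -> exists E, [/\ F E, (C `<=` E)%classic & (D `<=` E)%classic].
    by move=> FC FD; have [CD|DC] := Ftot _ _ FC FD; [exists D|exists C]; split.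
  (* Along a chain the spans form a directed union, so a dependence of [b] already occurs in one
     member. *)
  have [||W WP] := @subgroup_exists G
      (fun x => exists C, F C /\ generated (C `\ b)%classic U x).
  - by exists C0; split=> // W _ _; apply: rpred0.
  - move=> x y [C [FC Cx]] [D [FD Dy]]; have [E [FE CE DE]] := chain _ _ FC FD.
    exists E; split=> // W EW UW; apply: rpredB.
      by apply: (Cx W) => // a [/CE Ea ab]; apply: EW.
    by apply: (Dy W) => // a [/DE Ea ab]; apply: EW.
  move=> /(_ W) genb; have /WP[C [FC Cb]] : b \in W.
    apply: genb => [a [[C FC Ca] ab]|v vU]; apply/WP.
      by exists C; split=> // W' CW' _; apply: CW'.
    by exists C0; split=> // W' _; apply.
  have [E [FE C0E CE]] := chain _ _ FC0 FC.
  have := (FP E FE).2 b (C0E _ C0b); apply; apply: generated_sub Cb.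
  by move=> a [/CE].
exists B; split=> // s Ss; apply: contrapT => nBs.
have nB : ~ B s by move=> Bs; apply: nBs => W BW _; apply: BW.
apply: (Bmax (B `|` [set s])%classic).
  by split=> [x|/(_ s) Bs]; [left|apply/nB/Bs; right].
split=> [x [/BS //|-> //]|b Bsb genb].
have [bs|bs] := pselect (b = s).
  apply: nBs; rewrite -bs; apply: generated_sub genb.
  by move=> a [[//|/= ->] []].
have {Bsb} Bb : B b by case: Bsb.
have [||W0 W0P] := @subgroup_exists G (generated (B `\ b)%classic U).
- by move=> W _ _; apply: rpred0.
- by move=> x y Bx By W BW UW; apply: rpredB; [apply: Bx|apply: By].
have [W1 W1P] := adjoin_subgroup W0 s.
have W01 : {subset W0 <= W1} by move=> w wW; apply/W1P; exists w, 0; rewrite mulr0z addr0.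
have UW0 : {subset U <= W0} by move=> v vU; apply/W0P => W _; apply.
have BW0 a : (B `\ b)%classic a -> a \in W0 by move=> Ba; apply/W0P => W BW _; apply: BW.
have /W1P[w [c [wW bE]]] : b \in W1.
  apply: genb => [a [[Ba|/= ->] ab]|v /UW0 /W01 //]; first by apply: W01; apply: BW0.
  by apply/W1P; exists 0, 1; rewrite rpred0 add0r.
(* Exchange in [b = w + c s]: either [c s = 0] and [b] depends on the rest of [B], or [c] is
   invertible modulo [p] and [s] is generated. *)
have [pc|pc] := pselect (p %| c)%Z.
  by apply: (Bind b Bb); apply/W0P; rewrite bE (mulrz_dvd (Sp _ Ss) pc) addr0.
apply: nBs => W BW UW; apply: (prime_mulz_in pp (Sp _ Ss) pc).
rewrite -(addKr w (s *~ c)) -bE; apply: rpredD; last exact: BW.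
by rewrite rpredN; move/W0P: wW; apply=> // a [Ba _]; apply: BW.
Qed.

(** [J] sends one copy of [u] to each element of a basis of [S] modulo [U]. A nonzero [e] with [J e]
    in [U] would have a nonzero multiple in the socle, giving a dependence in the basis. *)
Lemma socle_basis (G Z : zmodType) p (S : set G) (U : zmodClosed G) (u : Z) :
    prime p -> (forall z : Z, exists t, z *+ p ^ t = 0) -> u *+ p = 0 ->
    (forall z, z *+ p = 0 -> exists c : int, z = u *~ c) ->
    (forall s, S s -> exists h : {additive Z -> G}, h u = s) ->
  exists (rho : choiceType) (J : {additive dsum (fun _ : rho => Z) -> G}),
    [/\ forall e, J e \in U -> e = 0,
        forall s, S s -> exists e v, v \in U /\ s = J e + v &
        finite_set S -> finite_set [set: rho]%classic].
Proof.
move=> pp Zp up usoc hS.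
have Sp s : S s -> s *+ p = 0 by move=> /hS[h <-]; rewrite -raddfMn up raddf0.
have [B [BS Bind Bgen]] := generated_basis U pp Sp.
pose rho : choiceType := {x : G | `[< B x >]}.
have rhoB (b : rho) : B (val b) by apply/asboolP; exact: (valP b).
have [h hE] : exists h : rho -> {additive Z -> G}, forall b, h b u = val b.
  have hP (b : rho) : exists h : {additive Z -> G}, h u = val b by apply/hS/BS/rhoB.
  by have [h hE] := choice hP; exists h.
have [J JE] := dsum_universal h; exists rho, J; split.
- move=> e eU; apply: contrapT => e0.
  have [t [et et0]] : exists t, e *+ p ^ t.+1 = 0 /\ e *+ p ^ t != 0.
    have ext : exists t, e *+ p ^ t == 0.
      by have [t te] := dsum_primary (fun=> Zp) e; exists t; apply/eqP.
    case: (ex_minnP ext) => -[|t] /eqP et tmin; first by rewrite mulr1n in et.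
    exists t; split=> //; apply: contraTN (leqnn t.+1) => et'.
    by rewrite -leqNgt; apply: leq_trans (tmin _ et') _; rewrite leqnn.
  pose f := e *+ p ^ t; have fU : J f \in U by rewrite raddfMn rpredMn.
  have [b0 fb0] : exists b0, f b0 != 0.
    apply: contrapT => nf; move/eqP: et0; apply; apply: dsumP => b; apply/eqP.
    by apply: contrapT => /negP fb; apply: nf; exists b.
  have [c cE] : exists c : rho -> int, forall b, f b = u *~ c b.
    have cP b : exists c : int, f b = u *~ c.
      by apply: usoc; rewrite -dsumMnE -mulrnA -expnSr et.
    by have [c cE] := choice cP; exists c.
  have pc : ~ (p %| c b0)%Z.
    by move=> pc; move/eqP: fb0; apply; rewrite cE; apply: mulrz_dvd up pc.
  apply: (Bind _ (rhoB b0)) => W BW UW.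
  apply: (prime_mulz_in pp (Sp _ (BS _ (rhoB b0))) pc).
  have [s [us sf]] := dsum_support f; move: fU; rewrite (JE _ _ us sf).
  rewrite (bigD1_seq b0) ?sf //= {1}cE raddfMz hE => /UW fW.
  rewrite -[X in X \in _](addrK (\sum_(b <- s | b != b0) h b (f b))) rpredB //.
  apply: rpred_sum => b bb0; rewrite cE raddfMz hE rpredMz //; apply: BW.
  by split=> [|/= /val_inj bb]; [apply: rhoB|rewrite bb eqxx in bb0].
- move=> s Ss; have [||W WP] := @subgroup_exists G (fun x => exists e v, v \in U /\ x = J e + v).
  + by exists 0, 0; rewrite rpred0 raddf0 addr0.
  + move=> _ _ [e [v [vU ->]]] [f [w [wU ->]]]; exists (e - f), (v - w).
    by rewrite rpredB // raddfB opprD addrACA.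
  apply/WP; apply: (Bgen s Ss) => [b Bb|v vU]; apply/WP; last first.
    by exists 0, v; rewrite raddf0 add0r.
  have bP : `[< B b >] by apply/asboolP.
  pose b' : rho := exist _ b bP.
  have [e eE] := single_exists b' u; exists e, 0; rewrite rpred0 addr0; split=> //.
  rewrite (JE _ [:: b']) //; last by move=> i; rewrite eE inE; case: (i == b') => //; rewrite eqxx.
  by rewrite big_seq1 eE eqxx hE.
- move=> Sfin; apply: (@sub_finite_set _ _ ((fun b : rho => val b) @^-1` S)%classic).
    by move=> b _; apply/BS/rhoB.
  by apply: finite_preimage Sfin => b c _ _; apply: val_inj.
Qed.

Lemma divisible_prime (X : zmodType) :
  (forall q, prime q -> forall x : X, exists y, y *+ q = x) -> divisible X.
Proof.
move=> Xq n; elim/ltn_ind: n => n IH x n0.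
have [n1|n1] := leqP n 1.
  by exists x; have -> : n = 1%N by apply/eqP; rewrite eqn_leq n1.
have pp := pdiv_prime n1; have dn := pdiv_dvd n.
have [y yx] := Xq _ pp x; have [||z zy] := IH (n %/ pdiv n)%N _ y.
- by rewrite ltn_Pdiv ?prime_gt1.
- by rewrite divn_gt0 ?prime_gt0 // dvdn_leq.
by exists z; rewrite -yx -zy -mulrnA divnK.
Qed.

Lemma primary_divisible (G : zmodType) p : prime p ->
    (forall x, x \in primary (X := G) p -> exists y, y *+ p = x) ->
  divisible (subgroup (primary (X := G) p)).
Proof.
move=> pp Gp; apply: divisible_prime => q qq [x xP]; have /asboolP[t xt] := xP.
have [->|qp] := eqVneq q p.
  have [y yx] := Gp x xP; have yP : y \in primary (X := G) p.
    by apply/asboolP; exists t.+1; rewrite expnS mulrnA yx.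
  by exists (Subgroup yP); apply: val_inj; rewrite raddfMn.
have [|c xc] := @coprime_divide _ x (p ^ t) q _ xt.
  by rewrite coprimeXl // prime_coprime // dvdn_prime2 // eq_sym.
have cP : x *~ c \in primary (X := G) p by rewrite rpredMz.
by exists (Subgroup cP); apply: val_inj; rewrite raddfMn /= -xc.
Qed.

(** The map from the span of [u] sending [u] to [s] extends because [T_p] is divisible. *)
Lemma prufer_hom (G : zmodType) p (u : prufer p) (s : G) : prime p ->
    (forall c : int, u *~ c = 0 -> (p %| c)%Z) ->
    (forall x, x \in primary (X := G) p -> exists y, y *+ p = x) -> s *+ p = 0 ->
  exists h : {additive prufer p -> G}, h u = s.
Proof.
move=> pp uc Gp sp; have sP : s \in primary (X := G) p.
  by apply/asboolP; exists 1%N; rewrite expn1.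
have [U UP] := trivial_subgroup (prufer p).
have [j jE] := mulrz_additive (fun _ : unit => u).
have [f fE] := mulrz_additive (fun _ : unit => Subgroup sP).
have [|F FE] := extendable_divisible (U := U) (primary_divisible pp Gp) (j := j tt) (f := f tt).
  move=> c; rewrite jE fE => /UP /uc pc; apply: val_inj.
  by rewrite raddfMz /= (mulrz_dvd sp pc).
exists (val \o F) => /=; have := FE 1; rewrite jE mulr1z => ->.
by rewrite fE mulr1z.
Qed.

(** A divisible sum built on a basis of [G[p]] splits off; its image contains [G[p]], so the kernel
    of [r] has no p-torsion. *)
Lemma prufer_layer (G : zmodType) p : prime p ->
    (forall x, x \in primary (X := G) p -> exists y, y *+ p = x) ->
  exists (rho : choiceType) (J : {additive dsum (fun _ : rho => prufer p) -> G})
    (r : {additive G -> dsum (fun _ : rho => prufer p)}),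
    [/\ forall e, r (J e) = e, forall x, r x = 0 -> x *+ p = 0 -> x = 0 &
        finite_set (psocle G p 0) -> finite_set [set: rho]%classic].
Proof.
move=> pp Gp; have [U UP] := trivial_subgroup G.
have [u [up uc usoc]] := prufer_cyclic pp 1; rewrite expn1 in up uc usoc.
have [|rho [J [JU SJ Sfin]]] := socle_basis (S := psocle G p 0) U pp (@prufer_primary p) up usoc.
  by move=> s [sp _]; apply: prufer_hom.
have [|r rJ] := extendable_divisible (U := U)
  (dsum_divisible (fun _ : rho => prufer_divisible pp)) (j := J) (f := idfun).
  exact: JU.
exists rho, J, r; split=> // x rx xp.
have [|e [v [/UP -> xE]]] := SJ x; first by split=> //; exists x.
by move: rx; rewrite xE addr0 rJ /= => ->; rewrite raddf0.
Qed.

(** The sum built on a basis of [psocle G p k] modulo [p^(k+1) G] meets [p^(k+1) G] trivially, so it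
    splits off. The second conclusion is the hypothesis for [k.+1] on the kernel of [r], ready for
    the next layer. *)
Lemma cyclic_layer (G : zmodType) p k : prime p ->
    (forall x : G, x *+ p ^ k = 0 -> exists y, y *+ p = x) ->
  exists (rho : choiceType) (J : {additive dsum (fun _ : rho => Zpow p (Some k.+1)) -> G})
    (r : {additive G -> dsum (fun _ : rho => Zpow p (Some k.+1))}),
    [/\ forall e, r (J e) = e,
        forall x, r x = 0 -> x *+ p ^ k.+1 = 0 -> exists y, r y = 0 /\ y *+ p = x &
        finite_set (psocle G p k) -> finite_set [set: rho]%classic].
Proof.
move=> pp Gp.
have [U UP] := multiples_subgroup G (p ^ k.+1).
have [w [wz wc whom]] := cyclic_generator pp k.+1; pose u := w *+ p ^ k.
have Zp (z : Zpow p (Some k.+1)) : exists t, z *+ p ^ t = 0.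
  by exists k.+1; apply: cyclic_exponent.
have up : u *+ p = 0 by rewrite -mulrnA -expnSr cyclic_exponent.
have usoc (z : Zpow p (Some k.+1)) : z *+ p = 0 -> exists c : int, z = u *~ c.
  have [c ->] := wz z; rewrite -mulrnA => wcp.
  have /wc pc : w *~ (c * p)%N = 0 by rewrite -pmulrn.
  have {pc} /dvdnP[b ->] : (p ^ k %| c)%N.
    by move: pc; rewrite dvdzE /= expnSr dvdn_pmul2r ?prime_gt0.
  by exists b; rewrite -pmulrn -mulrnA mulnC.
have [|rho [J [JU SJ Sfin]]] := socle_basis (S := psocle G p k) U pp Zp up usoc.
  move=> s [sp [y ys]]; have [|h hE] := whom G y; first by rewrite expnSr mulrnA ys.
  by exists h; rewrite raddfMn hE.
have [||||r rJ] := @extendable_homogeneous G U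
  (dsum (fun _ : rho => Zpow p (Some k.+1))) p k pp _ _ _ _ J idfun.
- by move=> e; apply: dsumP => i; rewrite dsumMnE cyclic_exponent.
- move=> e ek; apply: dsum_root => i; apply: (cyclic_root pp (ltnSn k)).
  by have := dsumMnE e (p ^ k) i; rewrite ek => <-.
- by move=> g; apply/UP; exists g.
- exact: JU.
have {}rJ e : r (J e) = e by apply: rJ.
exists rho, J, r; split=> // x rx xk.
have [|e [v [/UP[g ->] xE]]] := SJ (x *+ p ^ k).
  by split; [rewrite -mulrnA -expnSr|exists x].
(* [r] kills [x], and its target has exponent [p^(k+1)]. So [p^k x = p^(k+1) g], and the hypothesis
   divides [x - p g] by [p]; the root of [x] is then projected onto the kernel. *)
have e0 : e = 0.
  rewrite -(rJ e) -[J e](addrK (g *+ p ^ k.+1)) -xE raddfB !raddfMn rx mul0rn add0r.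
  by apply: dsumP => i; rewrite dsumMnE cyclic_exponent.
have [|h hp] := Gp (x - g *+ p).
  by rewrite mulrnBl xE e0 raddf0 add0r -mulrnA -expnS subrr.
have hgp : (h + g) *+ p = x by rewrite mulrnDl hp subrK.
exists (h + g - J (r (h + g))); split; first by rewrite raddfB rJ subrr.
by rewrite mulrnBl -!raddfMn hgp rx raddf0 subr0.
Qed.

(** * Structure of the primary components *)

(** Matching on the underlying number lets the type [X i] reduce, which avoids transport along
    equalities of ordinals. *)
Definition ord_cons (X : nat -> Type) n (a : X 0%N) (t : forall i : 'I_n, X i.+1)
    (i : 'I_n.+1) : X i :=
  let: Ordinal m lt_m := i in
  match m return (m < n.+1)%N -> X m with
  | 0%N => fun=> a
  | m'.+1 => fun lt_m' => t (Ordinal (lt_m' : m' < n)%N)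
  end lt_m.

Lemma ord_consE (X : nat -> Type) n (F : forall i : 'I_n.+1, X i) i :
  ord_cons (F ord0 : X 0%N) (fun j => F (lift ord0 j) : X j.+1) i = F i.
Proof.
case: i => -[|m] lt_m.
  exact: (f_equal (fun l : (0 < n.+1)%N => F (Ordinal l) : X 0%N) (bool_irrelevance _ lt_m)).
exact: (f_equal (fun l : (m.+1 < n.+1)%N => F (@Ordinal n.+1 m.+1 l) : X m.+1)
  (bool_irrelevance _ lt_m)).
Qed.

Lemma ord_dsum_exists (n : nat) (X : 'I_n -> zmodType) (F : forall i, X i) :
  exists f : dsum X, forall i, f i = F i.
Proof. exact/dsum_make/finite_finset. Qed.

Lemma dsum_recl (X : nat -> zmodType) n :
  exists (c : {additive (X 0%N * dsum (fun i : 'I_n => X i.+1))%type ->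
                 dsum (fun i : 'I_n.+1 => X i)})
    (d : {additive dsum (fun i : 'I_n.+1 => X i) ->
            (X 0%N * dsum (fun i : 'I_n => X i.+1))%type}),
    cancel c d /\ cancel d c.
Proof.
have cP (y : (X 0%N * dsum (fun i : 'I_n => X i.+1))%type) :
    exists f : dsum (fun i : 'I_n.+1 => X i), forall i,
      f i = @ord_cons (fun m => X m) n y.1 y.2 i.
  exact: ord_dsum_exists.
have [c cE] := choice cP.
have tP (f : dsum (fun i : 'I_n.+1 => X i)) :
    exists t : dsum (fun i : 'I_n => X i.+1), forall i, t i = (f (lift ord0 i) : X i.+1).
  exact: (@ord_dsum_exists n (fun i => X i.+1) (fun i => f (lift ord0 i))).
have [t tE] := choice tP.
have [|C CE] := @additive_exists _ _ c.
  by move=> [a1 f1] [a2 f2]; apply: dsumP => i; rewrite dsumBE !cE; case: i => -[|m] lt_m.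
have [|D DE] := @additive_exists (dsum (fun i : 'I_n.+1 => X i))
    (X 0%N * dsum (fun i : 'I_n => X i.+1))%type (fun f => ((f ord0 : X 0%N), t f)).
  by move=> f g; congr (_, _); apply: dsumP => i; rewrite dsumBE !tE.
exists C, D; split=> [[a f]|f].
  rewrite CE DE; congr (_, _); first exact: (cE (a, f) ord0).
  apply: dsumP => i; rewrite tE.
  have := cE (a, f) (lift ord0 i); case: i => m lt_m H; rewrite {}H.
  exact: (f_equal (fun l : (m < n)%N => f (Ordinal l) : X m.+1) (bool_irrelevance _ lt_m)).
rewrite DE CE; apply: dsumP => i; rewrite cE -[RHS](@ord_consE (fun m => X m)) /=.
by case: i => -[|m] lt_m //=; rewrite tE.
Qed.

Definition layers p n (alpha : nat -> option nat) (rho : nat -> choiceType) : zmodType :=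
  dsum (fun i : 'I_n => dsum (fun _ : rho i => Zpow p (alpha i))).

(* [S] is a direct summand of [G] whose complement, the kernel of [r], has no  *)
(* p-torsion.                                                                 *)
Definition split_torsion p (G : zmodType) (S : zmodType) : Prop :=
  exists (J : {additive S -> G}) (r : {additive G -> S}),
    (forall e, r (J e) = e) /\ (forall x, r x = 0 -> x *+ p = 0 -> x = 0).

Lemma split_torsion_cons (G : zmodType) p (X : nat -> zmodType) n
    (J0 : {additive X 0%N -> G}) (r0 : {additive G -> X 0%N}) (K : zmodClosed G) :
    (forall e, r0 (J0 e) = e) -> (forall x, (x \in K) <-> r0 x = 0) ->
    split_torsion p (subgroup K) (dsum (fun i : 'I_n => X i.+1)) ->
  split_torsion p G (dsum (fun i : 'I_n.+1 => X i)).
Proof.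
move=> rJ0 KP [J1 [r1 [rJ1 r1p]]]; have [c [d [cd dc]]] := dsum_recl X n.
have [q qE] : exists q : {additive G -> subgroup K}, forall x, val (q x) = x - J0 (r0 x).
  have qP x : exists k : subgroup K, val k = x - J0 (r0 x).
    have xK : x - J0 (r0 x) \in K by apply/KP; rewrite raddfB rJ0 subrr.
    by exists (Subgroup xK).
  have [q qE] := choice qP; have [|Q QE] := @additive_exists _ _ q.
    move=> x y; apply: val_inj; rewrite raddfB /= !qE.
    by rewrite (raddfB r0) (raddfB J0) opprD addrACA -opprD.
  by exists Q => x; rewrite QE.
have [J JE] : exists J : {additive dsum (fun i : 'I_n.+1 => X i) -> G},
    forall f, J f = J0 (d f).1 + val (J1 (d f).2).
  apply: additive_exists => f g.
  have [-> ->] : (d (f - g)).1 = (d f).1 - (d g).1 /\ (d (f - g)).2 = (d f).2 - (d g).2.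
    by rewrite (raddfB d).
  by rewrite (raddfB J0) (raddfB J1) raddfB /= opprD addrACA.
have [r rE] : exists r : {additive G -> dsum (fun i : 'I_n.+1 => X i)},
    forall x, r x = c (r0 x, r1 (q x)).
  by apply: additive_exists => x y; rewrite -(raddfB c) (raddfB r0) (raddfB q) (raddfB r1).
exists J, r; split=> [f|x].
  have r0J : r0 (J f) = (d f).1.
    rewrite JE raddfD rJ0; have /KP -> : val (J1 (d f).2) \in K by exact: valP.
    by rewrite addr0.
  rewrite rE r0J (_ : q (J f) = J1 (d f).2); last first.
    by apply: val_inj; rewrite qE r0J JE addrC addKr.
  by rewrite rJ1 -surjective_pairing dc.
rewrite rE -(raddf0 c) => /(can_inj cd) [r0x r1x] xp.
have xE : val (q x) = x by rewrite qE r0x raddf0 subr0.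
by rewrite -xE (r1p (q x)) ?raddf0 //; apply: val_inj; rewrite raddfMn /= xE xp.
Qed.

Lemma psocle_leq (G : zmodType) p m n : (m <= n)%N -> (psocle G p n `<=` psocle G p m)%classic.
Proof. by move=> /subnK <-; elim: (n - m)%N => // l IH s /psocleS /IH. Qed.

(** A decreasing sequence of subsets of a finite set is eventually constant; [d] is the largest
    index at which some element has left. *)
Lemma psocle_stable (G : zmodType) p k : finite_set (psocle G p k) ->
  exists d, forall n, (k + d <= n)%N -> (psocle G p n `<=` psocle G p n.+1)%classic.
Proof.
move=> /finite_seqP[s sE].
have hP (x : G) : exists h, (exists n, ~ psocle G p n x) -> ~ psocle G p h x.
  have [[n nx]|nx] := pselect (exists n, ~ psocle G p n x); first by exists n.
  by exists 0%N.
have [h hE] := choice hP; exists (\max_(x <- s) h x) => n kn x xn.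
apply: contrapT => xn1; have := hE x (ex_intro _ n.+1 xn1); apply.
apply: psocle_leq (xn); apply: leq_trans (kn); apply: leq_trans (leq_addl _ _).
rewrite (leq_bigmax_seq (F := h)) //.
have : psocle G p k x by apply: psocle_leq xn; apply: leq_trans kn; rewrite leq_addr.
by rewrite sE.
Qed.

Lemma split_torsion0 (G : zmodType) p (X : 'I_0 -> zmodType) :
  (forall x : G, x *+ p = 0 -> x = 0) -> split_torsion p G (dsum X).
Proof.
move=> Gp; have [|J _] := @additive_exists (dsum X) G (fun=> 0).
  by move=> _ _; rewrite subr0.
have [|r _] := @additive_exists G (dsum X) (fun=> 0).
  by move=> _ _; rewrite subr0.
exists J, r; split=> [e|x _]; last exact: Gp.
by apply: dsumP => -[].
Qed.

Lemma divisible_layers (G : zmodType) p : prime p ->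
    (forall x, x \in primary (X := G) p -> exists y, y *+ p = x) ->
  exists rho : choiceType, split_torsion p G (layers p 1 (fun=> None) (fun=> rho)) /\
    (finite_set (psocle G p 0) -> finite_set [set: rho]%classic).
Proof.
move=> pp Gp; have [rho [J [r [rJ rp rfin]]]] := prufer_layer pp Gp.
exists rho; split=> //; have [K KP] := kernel_subgroup r.
apply: (@split_torsion_cons G p (fun=> dsum (fun _ : rho => prufer p)) 0 J r K rJ KP).
apply: split_torsion0 => -[x xK] /(congr1 val); rewrite raddfMn /= => xp.
by apply: val_inj; apply: rp => //; apply/KP.
Qed.

Definition ncons_fun (T : Type) (a : T) (f : nat -> T) (m : nat) : T :=
  if m is m'.+1 then f m' else a.

Definition increasing_exponents (n : nat) (alpha : nat -> option nat) :=
  forall i j, (i < j < n)%N -> lt_oo (alpha i) (alpha j).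

Lemma increasing_exponents1 alpha : increasing_exponents 1 alpha.
Proof. by move=> i [|j]; rewrite ?andbF ?ltn0. Qed.

Lemma increasing_cons k n alpha :
    increasing_exponents n alpha -> (forall i, (i < n)%N -> lt_oo (Some k) (alpha i)) ->
  increasing_exponents n.+1 (ncons_fun (Some k) alpha).
Proof. by move=> inc ka [|i] [|j] //=; [apply: ka|apply: inc]. Qed.

Lemma cyclic_layers_step (G : zmodType) p k : prime p ->
    (forall x : G, x *+ p ^ k = 0 -> exists y, y *+ p = x) ->
  exists (rho : choiceType) (K : zmodClosed G),
    [/\ forall x : subgroup K, x *+ p ^ k.+1 = 0 -> exists y, y *+ p = x,
      finite_set (psocle G p k.+1) -> finite_set (psocle (subgroup K) p k.+1),
      forall n, (psocle G p n `<=` psocle G p n.+1)%classic ->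
        (psocle (subgroup K) p n `<=` psocle (subgroup K) p n.+1)%classic,
      finite_set (psocle G p k) -> finite_set [set: rho]%classic &
      forall n alpha r, split_torsion p (subgroup K) (layers p n alpha r) ->
        split_torsion p G (layers p n.+1 (ncons_fun (Some k.+1) alpha) (ncons_fun rho r))].
Proof.
move=> pp Gp; have [rho [J [r [rJ rp rfin]]]] := cyclic_layer pp Gp.
have [K KP] := kernel_subgroup r; exists rho, K; split=> //.
- move=> [x xK] /(congr1 val); rewrite raddfMn /= => xp.
  have [|y [/KP yK yx]] := rp x _ xp; first exact/KP.
  by exists (Subgroup yK); apply: val_inj; rewrite raddfMn.
- move=> fin; apply: (@sub_finite_set _ _ (val @^-1` psocle G p k.+1)%classic).
    move=> x [xp [y yx]]; split; first by rewrite -raddfMn xp raddf0.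
    by exists (val y); rewrite -yx raddfMn.
  by apply: finite_preimage fin => x y _ _; apply: val_inj.
- move=> n Gn x [xp [y yx]]; split=> //.
  have [|_ [g gx]] := Gn (val x).
    split; first by rewrite -raddfMn xp raddf0.
    by exists (val y); rewrite -yx raddfMn.
  have gK : g - J (r g) \in K by apply/KP; rewrite raddfB rJ subrr.
  exists (Subgroup gK); apply: val_inj; rewrite raddfMn /= mulrnBl gx -!raddfMn gx.
  have /KP -> : val x \in K by exact: valP.
  by rewrite raddf0 subr0.
- move=> n alpha sigma.
  exact: (@split_torsion_cons G p (fun m => dsum (fun _ : ncons_fun rho sigma m =>
    Zpow p (ncons_fun (Some k.+1) alpha m))) n J r K rJ KP).
Qed.

(* The layers Z(p^(k+1)), Z(p^(k+2)), ..., Z(p^(k+d)), Z(p^oo) are split off   *)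
(* in turn; some of them may be zero.                                         *)
Lemma bounded_layers p d : prime p -> forall (G : zmodType) k,
    (forall x : G, x *+ p ^ k = 0 -> exists y, y *+ p = x) ->
    finite_set (psocle G p k) ->
    (forall n, (k + d <= n)%N -> (psocle G p n `<=` psocle G p n.+1)%classic) ->
  exists n alpha rho, [/\ split_torsion p G (layers p n alpha rho),
    increasing_exponents n alpha, forall i, (i < n)%N -> lt_oo (Some k) (alpha i) &
    forall i, (i < n)%N -> finite_set [set: rho i]%classic].
Proof.
move=> pp; elim: d => [|d IH] G k Gp fin stab.
  (* Stability from [k] on makes [T_p] divisible: if [p^(t+1) x = 0] with [t >= k], then
     [p^t x = p^(t+1) y] for some [y], and [x - p y] is killed by [p^t]. *)
  have {}Gp x : x \in primary (X := G) p -> exists y, y *+ p = x.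
    move=> /asboolP[t]; elim: t x => [|t IH] x xt.
      by exists 0; rewrite mul0rn -xt mulr1n.
    have [tk|kt] := ltnP t k.
      by apply: Gp; rewrite -(subnKC tk) expnD mulrnA xt mul0rn.
    have [||_ [y yx]] := stab t _ (x *+ p ^ t); first by rewrite addn0.
      by split; [rewrite -mulrnA -expnSr|exists x].
    have [|z zx] := IH (x - y *+ p); first by rewrite mulrnBl -mulrnA -expnS yx subrr.
    by exists (z + y); rewrite mulrnDl zx subrK.
  have [rho [Gsplit rfin]] := divisible_layers pp Gp.
  exists 1%N, (fun=> None), (fun=> rho); split=> //; first exact: increasing_exponents1.
  (* When [T_p] is divisible, [psocle G p k] is the whole socle. *)
  move=> i _; apply: rfin; apply: sub_finite_set fin => s [sp _]; split=> //.
  elim: k {stab} => [|k [y yk]]; first by exists s.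
  have [|z zy] := Gp y; last by exists z; rewrite expnS mulrnA zy.
  by apply/asboolP; exists k.+1; rewrite expnSr mulrnA yk.
have [rho [K [Kp Kfin Kstab rfin Ksplit]]] := cyclic_layers_step pp Gp.
have [||n [alpha [sigma [/Ksplit Gsplit inc ka sfin]]]] := IH (subgroup K) k.+1 Kp.
- exact/Kfin/(sub_finite_set (@psocleS G p k)).
- by move=> n; rewrite addSnnS => /stab; apply: Kstab.
exists n.+1, (ncons_fun (Some k.+1) alpha), (ncons_fun rho sigma); split=> //.
- exact: increasing_cons.
- case=> [|i] /= ni; first exact: ltnSn.
  by have := ka i ni; case: (alpha i) => //= l; apply: ltn_trans.
- by case=> [|i] ni; [apply: rfin|apply: sfin].
Qed.

(** Only the first layer may be infinite: once it is split off, finiteness of [psocle G p k.+1]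
    bounds all later ones. *)
Lemma bounded_or_divisible_layers (G : zmodType) p : prime p -> bounded_or_divisible G p ->
  exists n alpha rho, [/\ split_torsion p G (layers p n.+1 alpha rho),
    increasing_exponents n.+1 alpha &
    forall i, (0 < i < n.+1)%N -> finite_set [set: rho i]%classic].
Proof.
move=> pp [Gp|[k [Gp fin]]].
  have [rho [Gsplit _]] := divisible_layers pp Gp.
  exists 0%N, (fun=> None), (fun=> rho); split=> // [|[|i]] //.
  exact: increasing_exponents1.
have [rho [K [Kp Kfin Kstab _ Ksplit]]] := cyclic_layers_step pp Gp.
have [d dstab] := psocle_stable (Kfin fin).
have [n [alpha [sigma [/Ksplit Gsplit inc ka sfin]]]] := bounded_layers pp Kp (Kfin fin) dstab.
exists n, (ncons_fun (Some k.+1) alpha), (ncons_fun rho sigma); split=> //.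
  exact: increasing_cons.
by case=> [|i] // /sfin.
Qed.

Lemma zpow_primary p a (z : Zpow p a) : prime p -> exists t, z *+ p ^ t = 0.
Proof.
case: a z => [a|] z pp; last exact: prufer_primary.
by exists a; apply: cyclic_exponent.
Qed.

Lemma layers_primary p n alpha rho (e : layers p n alpha rho) : prime p ->
  exists t, e *+ p ^ t = 0.
Proof.
move=> pp; apply: dsum_primary => i f; apply: dsum_primary => b z.
exact: zpow_primary.
Qed.

Lemma bounded_or_divisible_prank (G : zmodType) p : prime p -> bounded_or_divisible G p ->
  generalized_finite_prank p (subgroup (primary (X := G) p)).
Proof.
move=> pp /(bounded_or_divisible_layers pp)[n [alpha [rho [[J [r [rJ rp]]] inc rfin]]]].
exists n, (fun i => alpha i), (fun i => rho i); split.
- by move=> i j ij; apply: inc; rewrite ij ltn_ord.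
- by move=> j j0; apply: rfin; rewrite j0 ltn_ord.
exists (r \o val).
have JP e : J e \in primary (X := G) p.
  by have [t et] := layers_primary e pp; apply/asboolP; exists t; rewrite -raddfMn et raddf0.
exists (fun e => Subgroup (JP e)) => [[x xP]|e] /=; last exact: rJ.
apply: val_inj => /=; apply/eqP; rewrite -subr_eq0; apply/eqP.
have /asboolP[t] : J (r x) - x \in primary (X := G) p by rewrite rpredB.
have : r (J (r x) - x) = 0 by rewrite raddfB rJ subrr.
elim: t (J (r x) - x) => [|t IH] y ry yt; first by rewrite -yt mulr1n.
by apply: rp => //; apply: IH; rewrite ?raddfMn ?ry ?mul0rn // -mulrnA -expnS.
Qed.

(** The endomorphism [psi], identity on the p-torsion summand and multiplication by [p] on its
    complement, is injective. Its retraction [rho'] gives [g' = p rho'(g')] for [g'] in the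
    complement, and [g - g'] is torsion. *)
Lemma coBassian_quot_divisible (G : zmodType) : generalized_coBassian G ->
    (forall p, prime p -> bounded_or_divisible G p) ->
  divisible (Quotient.quot (torsion (X := G))).
Proof.
move=> Gco Gp; apply: divisible_prime => p pp x.
have [n [alpha [rho [[J [r [rJ rp]]] _ _]]]] := bounded_or_divisible_layers pp (Gp p pp).
have [psi psiE] : exists psi : {additive G -> G},
    forall g, psi g = (g - J (r g)) *+ p + J (r g).
  apply: additive_exists => a b; rewrite (raddfB r) (raddfB J).
  by rewrite (opprD _ (- J (r b))) addrACA -opprD mulrnBl [RHS]addrAC opprD addrA addrAC
    -!addrA; congr (_ + _); rewrite addrCA !addrA addrAC.
have [||rho' rhoK] := coBassian_retraction (q := idfun) (psi := psi) Gco.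
- by move=> y; exists y.
- apply: additive_inj => g; rewrite psiE => g0.
  have rg : r g = 0.
    by have := congr1 r g0; rewrite raddfD raddfMn raddfB rJ subrr mul0rn add0r raddf0.
  by apply: rp => //; move: g0; rewrite rg raddf0 subr0 addr0.
have [g <-] := quot_surj x; pose g' := g - J (r g).
have g'E : psi g' = g' *+ p by rewrite psiE /g' raddfB rJ subrr raddf0 subr0 addr0.
exists (\pi_(Quotient.quot (torsion (X := G))) (rho' g')).
rewrite -raddfMn; apply/quot_piE; rewrite -raddfMn -g'E rhoK /g' addrC addKr rpredN.
have [t et] := layers_primary (r g) pp.
by apply/asboolP; exists (p ^ t)%N; rewrite ?pexp_gt0 // -raddfMn et raddf0.
Qed.

Lemma bounded_or_divisible_iso (X Y : zmodType) (f : {additive X -> Y}) p :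
  bijective f -> bounded_or_divisible Y p -> bounded_or_divisible X p.
Proof.
move=> [g fK gK]; have finj := can_inj fK.
have root x d : d *+ p = f x -> exists y, y *+ p = x.
  by move=> dx; exists (g d); apply: finj; rewrite raddfMn gK.
case=> [Yp|[k [Yp fin]]]; [left=> x /asboolP[t xt]|right; exists k; split=> [x xk|]].
- have [|d /root //] := Yp (f x).
  by apply/asboolP; exists t; rewrite -raddfMn xt raddf0.
- by have [|d /root //] := Yp (f x); rewrite -raddfMn xk raddf0.
- apply: (@sub_finite_set _ _ (f @^-1` psocle Y p k.+1)%classic).
    move=> x [xp [y yx]]; split; first by rewrite -raddfMn xp raddf0.
    by exists (f y); rewrite -yx raddfMn.
  by apply: finite_preimage fin => x y _ _; apply: finj.
Qed.

Lemma bounded_or_divisible_primary (G : zmodType) p :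
  bounded_or_divisible (subgroup (primary (X := G) p)) p -> bounded_or_divisible G p.
Proof.
have lift (x : G) t : x *+ p ^ t = 0 -> exists x' : subgroup (primary (X := G) p),
    val x' = x /\ x' *+ p ^ t = 0.
  move=> xt; have xP : x \in primary (X := G) p by apply/asboolP; exists t.
  by exists (Subgroup xP); split=> //; apply: val_inj; rewrite raddfMn.
case=> [Gp|[k [Gp fin]]]; [left=> x /asboolP[t /lift[x' [<- xt]]]|right; exists k; split=> [x|]].
- have [|y <-] := Gp x'; first by apply/asboolP; exists t.
  by exists (val y); rewrite -raddfMn.
- by move=> /lift[x' [<- /Gp[y <-]]]; exists (val y); rewrite -raddfMn.
apply: sub_finite_set (finite_image val fin) => s [sp [y ys]].
have [|y' [y'E _]] := @lift y k.+2; first by rewrite expnSr mulrnA ys.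
have sE : val (y' *+ p ^ k.+1) = s by rewrite raddfMn /= y'E.
exists (y' *+ p ^ k.+1) => //; split; last by exists y'.
by apply: val_inj; rewrite raddfMn /= -/(val _) sE sp.
Qed.

Lemma zpow_socle_finite p a : prime p -> finite_set [set z : Zpow p a | z *+ p = 0]%classic.
Proof.
move=> pp; case: a => [a|]; first exact: (@finite_finset 'I_(p ^ a).-1.+1).
have [u [up _ usoc]] := prufer_cyclic pp 1; rewrite expn1 in up usoc.
apply: (@sub_finite_set _ _ (zspan [:: u])).
  by move=> z /= /usoc[c ->]; exists (fun=> c); rewrite big_ord1.
apply: finite_zspan => x; rewrite inE => /eqP ->; apply/asboolP.
by exists p; first exact: prime_gt0.
Qed.

Lemma zpow_root p a k (z : Zpow p a) : prime p -> (a = Some k \/ lt_oo (Some k) a) ->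
  z *+ p ^ k.-1 = 0 -> exists d, d *+ p = z.
Proof.
move=> pp; case: a z => [a|] z ka zk; last exact: prufer_divisible (prime_gt0 pp).
case: k ka zk => [|k] ka zk; first by exists 0; rewrite mul0rn -zk.
apply: cyclic_root zk => //.
by case: ka => [[->]|/= /ltnW //].
Qed.

Lemma dsumMnE2 (I : Type) (K : I -> Type) (Z : I -> zmodType)
    (f : dsum (fun i => dsum (fun _ : K i => Z i))) n i b :
  (f *+ n) i b = f i b *+ n.
Proof. by rewrite !dsumMnE. Qed.

Lemma prank_bounded_or_divisible (G : zmodType) p : prime p ->
  generalized_finite_prank p (subgroup (primary (X := G) p)) -> bounded_or_divisible G p.
Proof.
move=> pp [n [alpha [rho [inc rfin [f fbij]]]]].
apply/bounded_or_divisible_primary/(bounded_or_divisible_iso fbij).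
case E : (alpha ord0) => [k|]; last first.
  have alphaN i : alpha i = None.
    have [->//|i0] := eqVneq i ord0.
    by have := inc ord0 i; rewrite E lt0n => /(_ i0).
  left=> x _; apply: dsum_root => i; apply: dsum_root => b.
  have Zdiv a : a = None -> divisible (Zpow p a) by move=> ->; apply: prufer_divisible.
  exact: (Zdiv _ (alphaN i)) (prime_gt0 pp).
have alphak i : alpha i = Some k \/ lt_oo (Some k) (alpha i).
  have [->|i0] := eqVneq i ord0; first by left.
  by right; rewrite -E; apply: inc; rewrite lt0n.
right; exists k.-1; split=> [x xk|].
  apply: dsum_root => i; apply: dsum_root => b; apply: zpow_root (alphak i) _ => //.
  by rewrite -(@dsumMnE2 _ _ (fun i => Zpow p (alpha i)) x) xk.
(* Multiples of [p^k] vanish in the first layer, of exponent [p^k]; the others are finite sums of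
   groups with finite socle. For [k = 0] the first layer is trivial, so the truncation in [k.-1]
   does no harm. *)
pose Q (i : 'I_n.+1) : set (copies (rho i) (Zpow p (alpha i))) :=
  if i == ord0 then [set 0]%classic
  else [set y : dsum (fun _ : rho i => Zpow p (alpha i)) | forall b, y b *+ p = 0]%classic.
apply: (@sub_finite_set _ _ [set x : dsum _ | forall i, Q i (x i)]%classic).
  have Z0 a (z : Zpow p a) : a = Some k -> z *+ p ^ k.-1.+1 = 0.
    move=> aE; subst a; case: k {E alphak} z => [|k] z /=.
      by have := cyclic_exponent pp z; rewrite expn0 mulr1n => ->; rewrite mul0rn.
    exact: cyclic_exponent.
  move=> x [xp [y yx]] i; rewrite /Q; case: eqP => [i0|_] /=.
    apply: dsumP => b; rewrite -yx.
    by rewrite (@dsumMnE2 _ _ (fun i => Zpow p (alpha i)) y) Z0 // i0.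
  by move=> b; rewrite -(@dsumMnE2 _ _ (fun i => Zpow p (alpha i)) x) xp.
apply: dsum_finite_box => [|i]; first exact: finite_finset.
rewrite /Q; case: eqP => [_|/eqP i0]; first exact: finite_set1.
apply: (@dsum_finite_box _ _ (fun=> [set z | z *+ p = 0]%classic)).
  by apply: rfin; rewrite lt0n.
by move=> b; apply: zpow_socle_finite.
Qed.

(** * Absolute direct summands *)

Lemma finite_uniq_seq (T : choiceType) (A : set T) : finite_set A ->
  exists2 s : seq T, uniq s & forall x, (x \in s) <-> A x.
Proof.
move=> /finite_seqP[s sE]; exists (undup s) => [|x]; first exact: undup_uniq.
by rewrite mem_undup sE.
Qed.

Lemma uniq_map_inj_in (T1 T2 : eqType) (f : T1 -> T2) (s : seq T1) :
  uniq (map f s) -> {in s &, injective f}.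
Proof.
elim: s => // a s IH /= /andP[fa us] x y; rewrite !inE.
move=> /predU1P[->|xs] /predU1P[->|ys] // fxy; last exact: IH.
  by rewrite fxy map_f in fa.
by rewrite -fxy map_f in fa.
Qed.

Section FiniteSocle.
Variables (N : zmodType) (p : nat).
Hypotheses (Np : forall x : N, exists t, x *+ p ^ t = 0).
Hypothesis Nfin : finite_set [set x : N | x *+ p = 0]%classic.

Lemma finite_annihilated m : finite_set [set x : N | x *+ p ^ m = 0]%classic.
Proof.
elim: m => [|m IH].
  by apply: (@sub_finite_set _ _ [set 0]%classic) => [x /=|]; rewrite ?mulr1n.
have rP (y : N) : exists z, (exists x, x *+ p = y) -> z *+ p = y.
  have [[x xy]|nx] := pselect (exists x, x *+ p = y); first by exists x.
  by exists 0.
have [r rE] := choice rP.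
apply: sub_finite_set (finite_image2 (fun y z => r y + z) IH Nfin) => x /= xm.
exists (x *+ p) => /=; first by rewrite -mulrnA -expnS.
exists (x - r (x *+ p)); last by rewrite addrC subrK.
by rewrite /= mulrnBl rE ?subrr //; exists x.
Qed.

(* The elements [l + h], with [l] in [ls] and [h] in the kernel of [q], are    *)
(* determined by [p ^ m (l + h)], in the kernel, up to the [p ^ m]-torsion.   *)
Lemma size_quotient_torsion (X : zmodType) (q : {additive N -> X}) m (ls K : seq N) :
    uniq (map q ls) -> (forall l, l \in ls -> q l *+ p ^ m = 0) ->
    (forall x : N, x *+ p ^ m = 0 -> x \in K) ->
  (size ls <= size K)%N.
Proof.
move=> uls lsm Km.
have [t tP] := choice Np; pose L := \max_(l <- ls) t l.
have lsL l : l \in ls -> l *+ p ^ L = 0.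
  move=> lls; have le : (t l <= L)%N by rewrite (leq_bigmax_seq (F := t)).
  by rewrite -(subnKC le) expnD mulrnA tP mul0rn.
(* The kernel of [q] may be infinite. Its part killed by [p^L] is finite and still contains every
   [p^m (l + h)]. *)
have [H uH HP] : exists2 H : seq N, uniq H & forall x, (x \in H) <-> q x = 0 /\ x *+ p ^ L = 0.
  by apply: finite_uniq_seq; apply: sub_finite_set (finite_annihilated L) => x [].
have bP (y : N) : exists b, (exists x, x *+ p ^ m = y) -> b *+ p ^ m = y.
  have [[x xy]|nx] := pselect (exists x, x *+ p ^ m = y); first by exists x.
  by exists 0.
have [b bE] := choice bP.
pose F l h := ((l + h) *+ p ^ m, l + h - b ((l + h) *+ p ^ m)).
have H0 : (0 < size H)%N.
  have : 0 \in H by apply/HP; rewrite raddf0 mul0rn.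
  by case: (H).
rewrite -(leq_pmul2r H0) -(size_allpairs F) [(size K * _)%N]mulnC -(size_allpairs pair).
apply: uniq_leq_size.
  apply: allpairs_uniq => //; first exact: map_uniq uls.
  move=> _ _ /allpairsP[[l h] [/= lls hH ->]] /allpairsP[[l' h'] [/= lls' hH' ->]] /=.
  move=> [E1 E2]; have E : l + h = l' + h'.
    by rewrite -[LHS](subrK (b ((l + h) *+ p ^ m))) E2 E1 subrK.
  have ll' : l = l'.
    have := congr1 q E; rewrite !raddfD (proj1 ((HP h).1 hH)) (proj1 ((HP h').1 hH')) !addr0.
    exact: (uniq_map_inj_in uls).
  by move: E; rewrite ll' => /addrI ->.
move=> _ /allpairsP[[l h] [/= lls /HP[qh hL] ->]].
apply/allpairsP; exists (F l h); split=> //=.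
  apply/HP; split; first by rewrite raddfMn raddfD qh addr0 lsm.
  by rewrite -mulrnA mulnC mulrnA mulrnDl lsL // hL addr0 mul0rn.
by apply: Km; rewrite mulrnBl bE ?subrr //; exists (l + h).
Qed.

(** If [q n0] were outside the image of [psi], then [q n0] and the image of [N[p^m]] under [psi]
    would be too many elements of [q(N)] killed by [p^m]. *)
Lemma coHopfian (X : zmodType) (q psi : {additive N -> X}) : injective psi ->
  (forall x, exists y, q y = psi x) -> forall y, exists x, psi x = q y.
Proof.
move=> psi_inj psiq n0; apply: contrapT => nn0; have [m n0m] := Np n0.
have [K uK KP] := finite_uniq_seq (finite_annihilated m).
have [l lE] := choice psiq.
have qE : map q (n0 :: map l K) = q n0 :: map psi K.
  by rewrite /= -map_comp; congr (_ :: _); apply: eq_map => x; apply: lE.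
suff : (size (n0 :: map l K) <= size K)%N by rewrite /= size_map ltnn.
apply: (size_quotient_torsion (q := q) (m := m)); first rewrite qE /=.
- rewrite (map_inj_uniq psi_inj) uK andbT; apply/mapP => -[x _ xE].
  by apply: nn0; exists x.
- move=> x; rewrite inE => /predU1P[->|/mapP[y /KP yK ->]].
    by rewrite -raddfMn n0m raddf0.
  by rewrite lE -raddfMn yK raddf0.
- by move=> x /KP.
Qed.

End FiniteSocle.

(** If [t] has order dividing [m p^e] with [m] prime to [p], then [p^e t] is killed by [m], hence
    equal to [p^L c p^e t] for some [c]. So [p^e] kills [t - p^L c t]. *)
Lemma torsion_split (X : zmodType) p L (t : X) : prime p -> t \in torsion (X := X) ->
  exists t' c, t' \in primary (X := X) p /\ t = t' + t *~ c *+ p ^ L.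
Proof.
move=> pp /asboolP[n n0 tn]; have [m pm nE] := pfactor_coprime pp n0.
have [||c tc] := @coprime_divide _ (t *+ p ^ logn p n) m (p ^ L).
- by rewrite coprimeXr // coprime_sym.
- by rewrite -mulrnA mulnC -nE.
exists (t - t *~ c *+ p ^ L), c; split; last by rewrite subrK.
apply/asboolP; exists (logn p n); rewrite mulrnBl {1}tc [t *~ c *+ _ *+ _]mulrnAC.
have -> : t *~ c *+ p ^ logn p n = t *+ p ^ logn p n *~ c.
  by rewrite !pmulrn -!mulrzA mulrC.
by rewrite subrr.
Qed.

Section CoBassianSummand.
Variables (G : zmodType) (H : zmodClosed G) (phi : {additive G -> Quotient.quot H}).
Hypotheses (phi_inj : injective phi).
Let T : zmodClosed G := torsion (X := G).
Let pi : {additive G -> Quotient.quot H} := \pi_(Quotient.quot H).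

Lemma divisible_summand V : divisible G -> is_high (im phi) V ->
  direct_decomposition (im phi) V.
Proof.
move=> Gdiv; apply: high_divisible => p _ pp /asboolP[g <-].
have [g' <-] := Gdiv p g (prime_gt0 pp); exists (phi g'); last by rewrite raddfMn.
by apply/asboolP; exists g'.
Qed.

Lemma phi_torsion g n : (0 < n)%N -> phi g *+ n = 0 -> g \in T.
Proof.
move=> n0 gn; apply/asboolP; exists n => //; apply: phi_inj.
by rewrite raddfMn gn raddf0.
Qed.

(** Let the [g i] be a maximal independent family modulo [T], and lift [phi (g i)] to [x i]. A
    relation among the [x i] passes to the [g i], so by maximality every [y] depends on the [x i]
    modulo [T]; both claims are read off in [G / H]. *)
Lemma finite_rank_quotient : finite_rank (Quotient.quot T) ->
  (forall x, exists n, (0 < n)%N /\ x *+ n \in im phi) /\ {subset H <= T}.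
Proof.
move=> [r [[v vind] rmax]].
have [g gv] := choice (fun i => quot_surj (v i)).
have gind (c : 'I_r -> int) : \sum_i g i *~ c i \in T -> forall i, c i = 0.
  move=> cT; apply: vind; under eq_bigr => i _ do rewrite -gv.
  by rewrite quot_sum; apply/quot_pi0.
have [x xE] := choice (fun i => quot_surj (phi (g i))).
have pix (c : 'I_r -> int) : pi (\sum_i x i *~ c i) = phi (\sum_i g i *~ c i).
  rewrite !raddf_sum; apply: eq_bigr => i _.
  by rewrite (raddfMz pi) (raddfMz phi) -xE.
have dep y : exists c0 (c : 'I_r -> int), c0 != 0 /\ y *~ c0 + \sum_i x i *~ c i \in T.
  apply: contrapT => ndep.
  pose yx (i : 'I_r.+1) := if unlift ord0 i is Some j then x j else y.
  suff /rmax : independent (fun i => \pi_(Quotient.quot T) (yx i)) by rewrite ltnn.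
  move=> c; rewrite quot_sum => /quot_pi0; rewrite big_ord_recl /yx unlift_none.
  under eq_bigr => i _ do rewrite liftK.
  move=> cT; have c0 : c ord0 = 0.
    apply: contrapT => /eqP c0; apply: ndep.
    by exists (c ord0), (fun i => c (lift ord0 i)).
  move=> i; have [j ->|-> //] := unliftP ord0 i.
  apply: (gind (fun i => c (lift ord0 i))).
  move: cT; rewrite c0 mulr0z add0r => /asboolP[n n0 /(congr1 pi)].
  by rewrite raddfMn raddf0 pix => /phi_torsion; apply.
split=> [z|h hH].
  have [y yz] := quot_surj z; have [c0 [c [c0n /asboolP[n n0 /(congr1 pi)]]]] := dep y.
  rewrite raddf0 raddfMn raddfD pix raddfMz /pi /= yz => E.
  have zcn : z *~ c0 *+ n \in im phi.
    apply/asboolP; exists (- (\sum_i g i *~ c i) *+ n).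
    by rewrite raddfMn raddfN mulNrn; apply/esym/eqP; rewrite -addr_eq0 -mulrnDl E.
  exists (`|c0| * n)%N; rewrite muln_gt0 absz_gt0 c0n; split=> //.
  rewrite mulrnA; case: (c0) zcn => l //.
  by rewrite NegzE mulrNz mulNrn rpredN.
have [c0 [c [c0n yT]]] := dep h; apply: (torsion_divz c0n).
suff c_eq0 : forall i, c i = 0.
  by move: yT; rewrite big1 ?addr0 // => i _; rewrite c_eq0 mulr0z.
have /asboolP[n n0 /(congr1 pi)] := yT.
rewrite raddf0 raddfMn raddfD pix raddfMz /pi /= (quot_pi0 _ _).2 // mul0rz add0r.
by move=> /(phi_torsion n0) /gind.
Qed.

Lemma primary_lift p (x : Quotient.quot H) : prime p -> {subset H <= T} ->
  x \in primary (X := Quotient.quot H) p -> exists2 y, y \in primary (X := G) p & pi y = x.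
Proof.
move=> pp HT /asboolP[f xf]; have [y0 y0x] := quot_surj x.
have y0H : y0 *+ p ^ f \in H by apply/(quot_pi0 H); rewrite raddfMn /= y0x.
have y0T : y0 \in T.
  have /asboolP[n n0 yn] := HT _ y0H; apply/asboolP; exists (p ^ f * n)%N.
    by rewrite muln_gt0 expn_gt0 prime_gt0.
  by rewrite mulrnA.
have [y [c [yP yE]]] := torsion_split f pp y0T; exists y => //.
rewrite -y0x yE /pi raddfD /= [X in _ + X](quot_pi0 _ _).2 ?addr0 //.
by rewrite pmulrn -mulrzA mulrC mulrzA -pmulrn rpredMz.
Qed.

(** The group [N = p^(k+1) T_p] has finite socle, so [coHopfian] gives [pi(N) <= phi(N)]. With [v]
    replaced by a p-primary [v'], multiplying the equation by [p^k] puts [p^k v'] in [phi(G)] as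
    well as in [V]. So it is 0, [p^k g] lies in [p^(k+1) G], and the hypothesis on [G[p^k]] divides
    [g]. *)
Lemma bounded_or_divisible_divides V p k g v x :
    prime p -> is_high (im phi) V -> {subset H <= T} -> v \in V ->
    v \in torsion (X := Quotient.quot H) ->
    (forall x : G, x *+ p ^ k = 0 -> exists y, y *+ p = x) ->
    finite_set (psocle G p k.+1) -> g \in primary (X := G) p ->
    x *+ p = phi g + v -> exists h, h *+ p = g.
Proof.
move=> pp hV HT vV vT Gp fin gP xE.
have [v' [c [v'P vE]]] := torsion_split 1 pp vT; rewrite expn1 in vE.
have v'V : v' \in V by rewrite -(addrK (v *~ c *+ p) v') -vE rpredB // rpredMn // rpredMz.
have zE : (x - v *~ c) *+ p = phi g + v' by rewrite mulrnBl xE {1}vE addrA addrK.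
have zP : x - v *~ c \in primary (X := Quotient.quot H) p.
  have : (x - v *~ c) *+ p \in primary (X := Quotient.quot H) p.
    rewrite zE rpredD //; have /asboolP[t gt] := gP.
    by apply/asboolP; exists t; rewrite -raddfMn gt raddf0.
  by move=> /asboolP[t zt]; apply/asboolP; exists t.+1; rewrite expnS mulrnA.
have [y yP yz] := primary_lift pp HT zP.
have [||Nc NP] := @subgroup_exists G
    (fun s => exists2 w, w \in primary (X := G) p & s = w *+ p ^ k.+1).
- by exists 0; rewrite ?rpred0 ?mul0rn.
- by move=> _ _ [a aP ->] [b bP ->]; exists (a - b); rewrite ?rpredB ?mulrnBl.
have yN : y *+ p ^ k.+1 \in Nc by apply/NP; exists y.
have [||||w wE] := @coHopfian (subgroup Nc) p _ _ (Quotient.quot H)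
  (pi \o val) (phi \o val) _ _ (Subgroup yN).
- move=> [s sN]; have /NP[w /asboolP[t wt] sE] := sN; exists t.
  by apply: val_inj; rewrite raddfMn /= sE mulrnAC wt mul0rn.
- apply: (@sub_finite_set _ _ (val @^-1` psocle G p k.+1)%classic).
    move=> [s sN] /= /(congr1 val); rewrite raddfMn /= => sp; split=> //.
    by have /NP[w _ ->] := sN; exists w.
  by apply: finite_preimage fin => a b _ _; apply: val_inj.
- by move=> a b /= /phi_inj; apply: val_inj.
- move=> [s sN] /=; have /NP[w wP sE] := sN.
  have [|w' w'P w'E] := @primary_lift p (phi w) pp HT.
    have /asboolP[t wt] := wP.
    by apply/asboolP; exists t; rewrite -raddfMn wt raddf0.
  have w'N : w' *+ p ^ k.+1 \in Nc by apply/NP; exists w'.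
  by exists (Subgroup w'N); rewrite /= sE !raddfMn /= w'E.
have /NP[z zP' zE'] : val w \in Nc by exact: valP.
have {wE} wE : phi (z *+ p ^ k.+1) = phi (g *+ p ^ k) + v' *+ p ^ k.
  move: wE => /=; rewrite zE' => ->; rewrite raddfMn /= yz.
  by rewrite expnS mulrnA zE mulrnDl raddfMn.
have vk : v' *+ p ^ k = 0.
  apply: hV.1; first by rewrite rpredMn.
  apply/asboolP; exists (z *+ p ^ k.+1 - g *+ p ^ k).
  by rewrite raddfB wE addrC addKr.
have gz : (g - z *+ p) *+ p ^ k = 0.
  rewrite mulrnBl -mulrnA -expnS; apply: phi_inj.
  by rewrite raddfB wE vk addr0 subrr raddf0.
have [h hE] := Gp _ gz; exists (h + z).
by rewrite mulrnDl hE subrK.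
Qed.

(** Since [G / T] is divisible, [g] is the sum of a multiple of [p] and an element [t] of [T_p].
    Moving the multiple into [x] leaves only [t] to be divided by [p]. *)
Lemma bounded_or_divisible_summand V :
  divisible (Quotient.quot T) -> finite_rank (Quotient.quot T) ->
  (forall p, prime p -> bounded_or_divisible G p) -> is_high (im phi) V ->
  direct_decomposition (im phi) V.
Proof.
move=> Tdiv Trank Gp hV; have [Xtors HT] := finite_rank_quotient Trank.
have VT v : v \in V -> v \in torsion (X := Quotient.quot H).
  move=> vV; have [n [n0 vn]] := Xtors v; apply/asboolP; exists n => //.
  by apply: hV.1 => //; rewrite rpredMn.
apply: high_decomposition => // p x _ v pp /asboolP[g <-] vV xE.
suff [h hE] : exists h, h *+ p = g.
  exists (phi h), 0; split=> //; [by apply/asboolP; exists h|exact: rpred0|].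
  by rewrite subr0 mulrnBl xE -raddfMn hE addrC addKr.
have [y yp] := Tdiv p (\pi_(Quotient.quot T) g) (prime_gt0 pp).
have [g1 g1y] := quot_surj y.
have gT : g - g1 *+ p \in T by apply/(quot_piE T); rewrite raddfMn /= g1y yp.
have [t [c [tP tE]]] := torsion_split 1 pp gT; rewrite expn1 in tE.
have gE : g = t + (g1 + (g - g1 *+ p) *~ c) *+ p.
  by rewrite mulrnDl addrCA -tE addrC subrK.
suff [h hE] : exists h, h *+ p = t.
  by exists (h + (g1 + (g - g1 *+ p) *~ c)); rewrite mulrnDl hE -gE.
have [tdiv|[k [kroot kfin]]] := Gp p pp; first exact: tdiv.
pose g2 := g1 + (g - g1 *+ p) *~ c.
apply: (@bounded_or_divisible_divides V p k t v (x - phi g2)) => //; first exact: VT.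
by rewrite mulrnBl xE {1}gE raddfD raddfMn addrAC addrK.
Qed.

End CoBassianSummand.

Theorem theorem3p6 (G : zmodType) :
  (absolutely_generalized_coBassian G <-> generalized_coBassian G) /\
  (generalized_coBassian G <->
    divisible G \/
    [/\ divisible (Quotient.quot (torsion (X := G))),
        finite_rank (Quotient.quot (torsion (X := G)))
      & forall p : nat, prime p ->
          generalized_finite_prank p (subgroup (primary (X := G) p))]).
Proof.
have abs_co : absolutely_generalized_coBassian G -> generalized_coBassian G.
  move=> Gabs H phi phi_inj; have [U UP] := trivial_subgroup (Quotient.quot H).
  (* A high subgroup containing 0 exists, and absoluteness makes it a complement. *)
  have [|V hV _] := @high_exists _ (im phi) U; first by move=> x /UP.
  by exists V; apply: Gabs.
have co_cond : generalized_coBassian G -> divisible G \/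
    [/\ divisible (Quotient.quot (torsion (X := G))),
        finite_rank (Quotient.quot (torsion (X := G)))
      & forall p : nat, prime p ->
          generalized_finite_prank p (subgroup (primary (X := G) p))].
  move=> Gco; have [|Gdiv] := pselect (divisible G); [by left|right].
  have Gp p : prime p -> bounded_or_divisible G p by exact: coBassian_bounded_or_divisible.
  split; first exact: coBassian_quot_divisible.
    by apply: contrapT => /(infinite_rank_divisible Gco).
  by move=> p pp; apply: bounded_or_divisible_prank (Gp p pp).
have cond_abs : divisible G \/
    [/\ divisible (Quotient.quot (torsion (X := G))),
        finite_rank (Quotient.quot (torsion (X := G)))
      & forall p : nat, prime p ->
          generalized_finite_prank p (subgroup (primary (X := G) p))] ->
    absolutely_generalized_coBassian G.
  move=> [Gdiv|[Tdiv Trank Gp]] H phi phi_inj V; first exact: divisible_summand.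
  by apply: bounded_or_divisible_summand => // p pp; apply: prank_bounded_or_divisible (Gp p pp).
by split; split; auto.
Qed.
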